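(* Let $n\ge 5$. There exist convex origin-symmetric bodies $K$ and $L$ in $\mathbb{S}^n$ (respectively, in $\mathbb{H}^n$) such that $$\mathrm{vol}_{n-1}(K\cap H)\le \mathrm{vol}_{n-1}(L\cap H)$$ for every central totally geodesic hyperplane $H$, but $\mathrm{vol}_n(K)>\mathrm{vol}_n(L)$.
   Context: Both spaces are modelled on the open unit ball $B^n\subset\mathbb{R}^n$ with the metric $ds^2=4\frac{dx_1^2+\cdots+dx_n^2}{(1+\delta|x|^2)^2}$, where $\delta=+1$ for $\mathbb{S}^n$ (an open hemisphere, via stereographic projection) and $\delta=-1$ for $\mathbb{H}^n$ (Poincaré ball). A body is a compact set with non-empty interior; it is convex if for any two of its points the geodesic segment of the metric joining them lies in the body. Origin-symmetric means $K=-K$. Central totally geodesic hyperplanes are $\{x:\langle x,\xi\rangle=0\}\cap B^n$, $\xi\in S^{n-1}$. Volumes are Riemannian volumes of the metric: $\mathrm{vol}_n(K)=2^n\int_K\frac{dx}{(1+\delta|x|^2)^n}$, $\mathrm{vol}_{n-1}(K\cap\xi^\perp)=2^{n-1}\int_{K\cap\xi^\perp}\frac{dx}{(1+\delta|x|^2)^{n-1}}$. *)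

(* Defs.v *)
From HB Require Import structures.
From mathcomp Require Import all_boot all_order all_algebra.
From mathcomp Require Import all_classical all_reals all_analysis.
Set Implicit Arguments. Unset Strict Implicit. Unset Printing Implicit Defensive.
Import Order.TTheory GRing.Theory Num.Theory.
Import numFieldNormedType.Exports.
Local Open Scope classical_set_scope.
Local Open Scope ring_scope.

Definition sqnorm (R : realType) (n : nat) (x : 'rV[R]_n) : R :=
  \sum_(i < n) (x ord0 i) ^+ 2.

(* n-fold iterated Lebesgue integral of a (nonnegative) extended-real
   function on R^n; for nonnegative Borel functions this is the integral
   against n-dimensional Lebesgue measure (Tonelli). *)
Fixpoint iint (R : realType) (n : nat) : ('rV[R]_n -> \bar R) -> \bar R :=
  match n with
  | 0 => fun f => f 0
  | m.+1 => fun f =>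
      (\int[@lebesgue_measure R]_t iint (fun y : 'rV[R]_m =>
                f (row_mx (t%:M : 'rV[R]_1) y)))%E
  end.

(* Riemannian n-volume of K in the ball model with curvature sign delta:
   vol_n(K) = 2^n \int_K dx / (1 + delta |x|^2)^n *)
Definition vol (R : realType) (delta : R) (n : nat) (K : set 'rV[R]_n) : \bar R :=
  ((2 ^+ n : R)%:E *
   iint (fun x => (\1_K x * (1 + delta * sqnorm x) ^- n)%:E))%E.

(* Riemannian (n-1)-volume of K ∩ H, where the hyperplane H through the
   origin is parametrized isometrically by y |-> y *m P, P having
   orthonormal rows:
   vol_{n-1}(K ∩ H) = 2^(n-1) \int_{K ∩ H} dx / (1 + delta |x|^2)^(n-1) *)
Definition secvol (R : realType) (delta : R) (n : nat)
    (P : 'M[R]_(n.-1, n)) (K : set 'rV[R]_n) : \bar R :=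
  ((2 ^+ n.-1 : R)%:E *
   iint (fun y : 'rV[R]_n.-1 =>
           (\1_K (y *m P) * (1 + delta * sqnorm (y *m P)) ^- n.-1)%:E))%E.

Definition ball_model (R : realType) (n : nat) : set 'rV[R]_n :=
  [set x | sqnorm x < 1].

(* Map from the conformal ball model to the projective model (gnomonic
   projection of the hemisphere for delta = 1, Klein model for delta = -1),
   in which geodesics are exactly (pieces of) straight lines. *)
Definition proj_model (R : realType) (delta : R) (n : nat) (x : 'rV[R]_n)
  : 'rV[R]_n := (2 / (1 - delta * sqnorm x)) *: x.

(* The geodesic segment of the metric ds^2 = 4|dx|^2/(1+delta|x|^2)^2
   joining a and b (points of the ball). *)
Definition geod_segment (R : realType) (delta : R) (n : nat) (a b : 'rV[R]_n)
  : set 'rV[R]_n :=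
  [set z | sqnorm z < 1 /\
     exists t : R, 0 <= t <= 1 /\
       proj_model delta z = (1 - t) *: proj_model delta a + t *: proj_model delta b].

Definition model_body (R : realType) (n : nat) (K : set 'rV[R]_n) : Prop :=
  K `<=` @ball_model R n /\ compact K /\ interior K !=set0.

Definition geod_convex (R : realType) (delta : R) (n : nat) (K : set 'rV[R]_n)
  : Prop :=
  forall a b, K a -> K b -> geod_segment delta a b `<=` K.

Definition origin_symmetric (R : realType) (n : nat) (K : set 'rV[R]_n) : Prop :=
  [set - x | x in K] = K.

(* Main.v *)
Require Import Defs.
From HB Require Import structures.
From mathcomp Require Import all_boot all_order all_algebra.
From mathcomp Require Import all_classical all_reals all_analysis.
From mathcomp Require Import measurable_realfun.
From mathcomp Require Import ring lra.
Import Order.TTheory GRing.Theory Num.Theory.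
Import numFieldNormedType.Exports.
Local Open Scope classical_set_scope.
Local Open Scope ring_scope.

(* In the projective model geodesics are straight and, near the origin, the
   metric is Euclidean up to a factor tending to a constant.  So it suffices to
   find Euclidean convex bodies violating the Busemann-Petty implication with a
   strict margin, and to shrink them.

   The Euclidean pair is a cylinder K = {|x'| <= 1, |x_0| <= 1} and a
   perturbation L = {|x'|^2 + 6e x_0^2 <= 1 + 2e(1-b), |x_0| <= H} of it, with
   H = 1 + e(k + 1/2)b and k = n - 2.  Slicing a body of revolution
   |x'| <= f(x_0) by a hyperplane whose normal has slope a gives, up to a common
   factor, the integral of (f(x)^2 - a^2 x^2)_+^(k/2), and its volume is the
   integral of f^(k+1).  To first order in e, the volume of L changes by
   (k + 1/2)b - (k + 1)b < 0, whereas the section with slope a changes by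
   k int w(x)(1 - b - 3x^2) + (k + 1/2)b (1 - a^2)^(k/2), where
   w(x) = (1 - a^2 x^2)^((k-2)/2).  Since w is decreasing in |x| and
   int (1 - 3x^2) = 0 on [-1, 1], Chebyshev's inequality makes the first term
   positive unless a is close to 0 (this needs k > 2, i.e. n > 4); for a close to
   0 the second term wins because k + 1/2 > k.  Slopes a > 1 reduce to a = 1. *)

(** * Lebesgue and iterated integrals *)

Section affine_substitution.
Context {R : realType}.
Local Notation mu := (@lebesgue_measure R).

Let aff (a b : R) : measurableTypeR R -> measurableTypeR R :=
  fun x => a * x + b.

Let measurable_aff (a b : R) : measurable_fun setT (aff a b).
Proof. by apply: measurable_funD => //; exact: measurable_funM. Qed.

(** By uniqueness of Lebesgue measure it is enough to compare both sides on half-open intervals. For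
    a < 0 the preimage is half-open at the other end, which leaves its length unchanged. *)
Lemma lebesgue_measure_affine (a b : R) (A : set R) : a != 0 -> measurable A ->
  mu A = (`|a|%:E * pushforward mu (aff a b) A)%E.
Proof.
move=> a0 mA.
have a_ge0 : 0 <= `|a| by [].
pose aff_mfun := isMeasurableFun.Build _ _ _ _ (aff a b) (measurable_aff a b).
pose phi : {mfun measurableTypeR R >-> measurableTypeR R} :=
  HB.pack (aff a b) aff_mfun.
rewrite (@lebesgue_measure_unique R
  (mscale (NngNum a_ge0) (pushforward mu phi))) //.
move=> _ [[u v] _ <-] /=.
rewrite /mscale /= -[pushforward _ _ _]/(mu (aff a b @^-1` `]u, v]%classic)).
have [a_gt0|a_le0] := ltP 0 a.
  have -> : aff a b @^-1` `]u, v]%classic =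
    `](u - b) / a, (v - b) / a]%classic.
    apply/seteqP; split => x /=; rewrite /aff !in_itv /=
      ltr_pdivrMr// ler_pdivlMr// ltrBlDr lerBrDr [x * a]mulrC //.
  rewrite !lebesgue_measure_itv /= !lte_fin gtr0_norm//.
  rewrite ltr_pM2r ?invr_gt0// ltrD2r; case: ifP; rewrite ?mule0// => _.
  by rewrite -!EFinB -EFinM; congr EFin; field.
have a_lt0 : a < 0 by rewrite lt_neqAle a0.
have -> : aff a b @^-1` `]u, v]%classic =
    `[(v - b) / a, (u - b) / a[%classic.
  by apply/seteqP; split => x /=; rewrite /aff !in_itv /=
    ler_ndivrMr// ltr_ndivlMr// lerBrDr ltrBlDr [x * a]mulrC andbC.
rewrite !lebesgue_measure_itv /= !lte_fin ltr0_norm//.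
rewrite ltr_nM2r ?invr_lt0// ltrD2r; case: ifP; rewrite ?mule0// => _.
by rewrite -!EFinB -EFinM; congr EFin; field.
Qed.

Lemma ge0_integral_affine (a b : R) (f : R -> \bar R) : a != 0 ->
  measurable_fun setT f -> (forall x, 0 <= f x)%E ->
  (\int[mu]_x f x = `|a|%:E * \int[mu]_x f (a * x + b)%R)%E.
Proof.
move=> a0 mf f0.
have a_ge0 : 0 <= `|a| by [].
pose aff_mfun := isMeasurableFun.Build _ _ _ _ (aff a b) (measurable_aff a b).
pose phi : {mfun measurableTypeR R >-> measurableTypeR R} :=
  HB.pack (aff a b) aff_mfun.
rewrite (@eq_measure_integral _ _ _ _
    (mscale (NngNum a_ge0) (pushforward mu phi))); last first.
  by move=> A mA _; exact: lebesgue_measure_affine.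
rewrite ge0_integral_mscale //=.
by rewrite ge0_integral_pushforward.
Qed.

End affine_substitution.

Section ge0_integral_nomeas.
Context d (T : measurableType d) (R : realType) (mu : {measure set T -> \bar R}).
Local Open Scope ereal_scope.
Import HBNNSimple.

(** Read off from the integral as a supremum over simple functions below the integrand, so that it
    covers the inner integrals in [iint], whose measurability in the outer variable is not
    established in general. *)
Lemma ge0_le_integralT (f g : T -> \bar R) :
  (forall x, 0 <= f x) -> (forall x, f x <= g x) ->
  \int[mu]_x f x <= \int[mu]_x g x.
Proof.
move=> f0 fg; have g0 x : 0 <= g x by exact: le_trans (fg x).
rewrite !ge0_integralTE//; apply: ereal_sup_le => _ [h hf <-].
by exists h => // x; exact: le_trans (fg x).
Qed.

(** One inequality, for all positive scalars, suffices: applied to 1/c it gives the reverse one. It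
    holds because scaling a simple function below g gives one below a g. *)
Lemma gt0_integralTZl (c : R) (f : T -> \bar R) :
  (0 < c)%R -> (forall x, 0 <= f x) ->
  \int[mu]_x (c%:E * f x) = c%:E * \int[mu]_x f x.
Proof.
suff le_Zl (a : R) (g : T -> \bar R) : (0 < a)%R -> (forall x, 0 <= g x) ->
    a%:E * \int[mu]_x g x <= \int[mu]_x (a%:E * g x).
  move=> c0 f0; have c0E : 0 <= c%:E by rewrite lee_fin ltW.
  apply/eqP; rewrite eq_le le_Zl// andbT.
  rewrite -lee_pdivrMl// (le_trans (le_Zl _ _ _ _))// ?invr_gt0//.
    by move=> x; rewrite mule_ge0.
  under eq_integral do rewrite muleA -EFinM mulVf ?gt_eqF// mul1e.
  by [].
move=> a0 g0; have ag0 x : 0 <= a%:E * g x by rewrite mule_ge0// lee_fin ltW.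
rewrite !ge0_integralTE// -ereal_sup_pZl//.
apply: ereal_sup_le => _ [_ [h hg <-] <-].
exists (scale_nnsfun h (ltW a0)) => /= [x|].
  by rewrite EFinM lee_pmul2l.
exact: sintegralrM.
Qed.

End ge0_integral_nomeas.

Section iterated_integral.
Context {R : realType}.
Local Notation mu := (@lebesgue_measure R).
Local Open Scope ereal_scope.

Lemma iint_ge0 n (f : 'rV[R]_n -> \bar R) : (forall x, 0 <= f x) -> 0 <= iint f.
Proof.
elim: n f => [|n IHn] f f0 /=; first exact: f0.
by apply: integral_ge0 => t _; exact: IHn.
Qed.

Lemma le_iint n (f g : 'rV[R]_n -> \bar R) :
  (forall x, 0 <= f x) -> (forall x, f x <= g x) -> iint f <= iint g.
Proof.
elim: n f g => [|n IHn] f g f0 fg /=; first exact: fg.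
apply: ge0_le_integralT => t; first by apply: iint_ge0 => y.
exact: IHn.
Qed.

Lemma eq_iint n (f g : 'rV[R]_n -> \bar R) : f =1 g -> iint f = iint g.
Proof. by move=> /funext ->. Qed.

Lemma iintS n (f : 'rV[R]_n.+1 -> \bar R) :
  iint f = \int[mu]_t iint (fun y : 'rV[R]_n => f (row_mx (t%:M : 'rV_1) y)).
Proof. by []. Qed.

Lemma iint0 n : iint (fun _ : 'rV[R]_n => 0) = 0.
Proof.
by elim: n => [//|n IHn] /=; rewrite integral0_eq// => t _; exact: IHn.
Qed.

Lemma iintZl n (c : R) (f : 'rV[R]_n -> \bar R) : (0 < c)%R ->
  (forall x, 0 <= f x) -> iint (fun x => c%:E * f x) = c%:E * iint f.
Proof.
move=> c0; elim: n f => [//|n IHn] f f0 /=.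
rewrite -gt0_integralTZl//; last by move=> t; exact: iint_ge0.
by apply: eq_integral => t _; rewrite IHn.
Qed.

End iterated_integral.

Section measurability.
Context {R : realType}.

Lemma measurable_fun_sqrt d (T : measurableType d) (D : set T) (f : T -> R) :
  measurable_fun D f -> measurable_fun D (fun x => Num.sqrt (f x)).
Proof.
move=> mf; apply: measurableT_comp => //.
by apply: continuous_measurable_fun; exact: sqrt_continuous.
Qed.

Lemma measurable_fun_bool_natr d (T : measurableType d) (b : T -> bool) :
  measurable_fun setT b -> measurable_fun setT (fun x => (b x)%:R : R).
Proof.
move=> mb; rewrite (_ : (fun x => _) = (fun x => if b x then 1 else 0)).
  exact: measurable_fun_ifT.
by apply/funext => x; case: (b x).
Qed.

End measurability.

(** * Volumes of Euclidean balls *)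

Section balls.
Context {R : realType}.
Local Notation mu := (@lebesgue_measure R).

Lemma integral_itvcc (a b : R) : a <= b ->
  (\int[mu]_t (a <= t <= b)%R%:R%:E = (b - a)%:E)%E.
Proof.
move=> ab; transitivity (\int[mu]_t (\1_(`[a, b]%classic) t)%:E)%E.
  by apply: eq_integral => t _; rewrite indicE mem_setE in_itv.
rewrite integral_indic// setIT.
transitivity (mu `[a, b]%classic) => //.
rewrite lebesgue_measure_itv /= lte_fin; case: ltP => // ba.
by rewrite (@le_anti _ _ a b) ?subrr// ab.
Qed.

Lemma sqnorm_ge0 n (x : 'rV[R]_n) : 0 <= sqnorm x.
Proof. by apply: sumr_ge0 => i _; exact: sqr_ge0. Qed.

Lemma row_mx_head n (t : R) (y : 'rV[R]_n) :
  (row_mx (t%:M : 'rV_1) y : 'rV_n.+1) ord0 ord0 = t.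
Proof.
rewrite (_ : ord0 = lshift n (ord0 : 'I_1)); last exact: val_inj.
by apply: (etrans (row_mxEl _ _ _ _)); rewrite mxE eqxx.
Qed.

Lemma row_mx_tail n (t : R) (y : 'rV[R]_n) (i : 'I_n) :
  (row_mx (t%:M : 'rV_1) y : 'rV_n.+1) ord0 (lift ord0 i) = y ord0 i.
Proof.
rewrite (_ : lift ord0 i = rshift 1 i); last exact: val_inj.
exact: row_mxEr.
Qed.

Lemma sqnorm_row_mx n (t : R) (y : 'rV[R]_n) :
  @sqnorm R n.+1 (row_mx t%:M y) = t ^+ 2 + sqnorm y.
Proof.
rewrite /sqnorm big_ord_recl row_mx_head.
by congr (_ + _); apply: eq_bigr => i _; rewrite row_mx_tail.
Qed.

(** Up to a constant, the volume of the n-dimensional slice at height t of the ball of squared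
    radius r. The indicator matters for n = 0, where the power of the root is 1 even on an empty
    slice. *)
Let slice n (r t : R) := Num.sqrt (r - t ^+ 2) ^+ n * (t ^+ 2 <= r)%R%:R.

Let slice_ge0 n r t : 0 <= slice n r t.
Proof. by rewrite mulr_ge0// exprn_ge0// sqrtr_ge0. Qed.

Let measurable_slice n r : measurable_fun setT (EFin \o slice n r).
Proof.
apply/measurable_EFinP/measurable_funM.
  by apply/measurable_funX/measurable_fun_sqrt/measurable_funB => //.
by apply/measurable_fun_bool_natr/measurable_fun_ler => //; exact: measurable_funX.
Qed.

(** The integrand is at least 2^-n on [-1/2, 1/2] and at most the indicator of [-1, 1]. *)
Let slice_int_gt0 n : exists2 I : R, 0 < I & (\int[mu]_t (slice n 1 t)%:E = I%:E)%E.
Proof.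
have lb : ((2^-1 ^+ n)%:E <= \int[mu]_t (slice n 1 t)%:E)%E.
  have -> : (2^-1 ^+ n)%:E =
      (\int[mu]_t ((2^-1 ^+ n)%:E * (- 2^-1 <= t <= 2^-1)%R%:R%:E)%E)%E.
    rewrite gt0_integralTZl ?exprn_gt0// integral_itvcc; last by lra.
    by rewrite -EFinM; congr EFin; lra.
  apply: ge0_le_integralT => t; rewrite -EFinM lee_fin; first by rewrite mulr_ge0// exprn_ge0.
  have [/andP[t1 t2]|] := boolP (_ <= _ <= _); rewrite ?mulr0// mulr1 /slice.
  have t2' : t ^+ 2 <= 4^-1 by nra.
  rewrite (_ : t ^+ 2 <= 1) ?mulr1; last by lra.
  rewrite lerXn2r// ?nnegrE ?sqrtr_ge0//.
  by rewrite -[leLHS]ger0_norm// -sqrtr_sqr ler_wsqrtr//; lra.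
have ub : (\int[mu]_t (slice n 1 t)%:E <= 2%:E)%E.
  apply: (@le_trans _ _ (\int[mu]_t (-1 <= t <= 1)%R%:R%:E)%E).
    apply: ge0_le_integralT => t; rewrite lee_fin//.
    rewrite /slice.
    have [t1|t1] := leP (t ^+ 2) 1; rewrite ?mulr0// mulr1.
    have -> : -1 <= t <= 1 by apply/andP; split; nra.
    rewrite exprn_ile1 ?sqrtr_ge0// -[leRHS]sqrtr1 ler_wsqrtr//.
    by have := sqr_ge0 t; lra.
  by rewrite integral_itvcc ?lee_fin; lra.
have p0 : 0 < 2^-1 ^+ n :> R by rewrite exprn_gt0.
have fin : (\int[mu]_t (slice n 1 t)%:E)%E \is a fin_num.
  rewrite ge0_fin_numE ?(le_lt_trans ub) ?ltry//.
  by apply: integral_ge0 => t _; rewrite lee_fin.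
exists (fine (\int[mu]_t (slice n 1 t)%:E)); last by rewrite fineK.
by rewrite -lte_fin fineK// (lt_le_trans _ lb)// lte_fin.
Qed.

(** Induction on n: slicing by the first coordinate gives [slice], and t -> sqrt(r) t extracts the
    power of r. The unit ball volume [kappa] is left implicit because it will occur on both sides of
    every comparison. *)
Lemma iint_ball n : exists2 kappa : R, 0 < kappa &
  forall r, iint (fun z : 'rV[R]_n => (sqnorm z <= r)%R%:R%:E) =
            (kappa * (Num.sqrt r ^+ n * (0 <= r)%R%:R))%:E.
Proof.
elim: n => [|n [kappa kappa0 IHn]].
  by exists 1 => // r /=; rewrite /sqnorm big_ord0 expr0 mul1r mul1r.
have [I I0 IE] := slice_int_gt0 n.
exists (kappa * I) => [|r /=]; first exact: mulr_gt0.
have inner t : iint (fun y : 'rV[R]_n => (@sqnorm R n.+1 (row_mx t%:M y) <= r)%R%:R%:E) =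
    (kappa%:E * (slice n r t)%:E)%E.
  rewrite (@eq_iint _ _ _ (fun y => (sqnorm y <= r - t ^+ 2)%R%:R%:E)).
    by rewrite IHn subr_ge0.
  by move=> y; rewrite sqnorm_row_mx lerBrDl.
under eq_integral do rewrite inner.
have g0 t : (0 <= (slice n r t)%:E)%E by rewrite lee_fin.
rewrite gt0_integralTZl//.
have [r0|r0|r0] := ltgtP 0 r; last 2 first.
- rewrite integral0_eq ?mule0 ?mulr0// => t _; rewrite /slice.
  rewrite (_ : _ <= r = false) ?mulr0//; apply/negbTE.
  by rewrite -ltNge (lt_le_trans r0)// sqr_ge0.
(* For r = 0 the integrand is at most the indicator of the single point t = 0. *)
- rewrite -r0 sqrtr0 expr0n/= mul0r mulr0.
  rewrite -[RHS](mule0 kappa%:E); congr (_ * _)%E.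
  apply/eqP; rewrite eq_le integral_ge0; last by move=> t _; rewrite r0.
  rewrite andbT (@le_trans _ _ (\int[mu]_t (0 <= t <= 0)%R%:R%:E)%E)//; last first.
    by rewrite integral_itvcc// subrr.
  apply: ge0_le_integralT => t; first by rewrite r0.
  rewrite lee_fin /slice; have [t0|t0] := boolP (t ^+ 2 <= 0); rewrite ?mulr0//.
  have -> : t = 0 by apply/eqP; rewrite -sqrf_eq0 eq_le t0 sqr_ge0.
  by rewrite lexx mulr1 exprn_ile1 ?sqrtr_ge0// expr0n subrr sqrtr0.
have s0 : 0 < Num.sqrt r by rewrite sqrtr_gt0.
rewrite (@ge0_integral_affine _ (Num.sqrt r) 0)//; [|by rewrite gt_eqF|exact: measurable_slice].
transitivity (kappa%:E * ((Num.sqrt r)%:E *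
    \int[mu]_t ((Num.sqrt r ^+ n)%:E * (slice n 1 t)%:E)))%E.
  congr (_ * (_ * _))%E; first by rewrite gtr0_norm.
  apply: eq_integral => t _; rewrite -EFinM /slice addr0 exprMn sqr_sqrtr ?(ltW r0)//.
  rewrite -{1}[r]mulr1 -mulrBr sqrtrM ?(ltW r0)// exprMn -mulrA.
  by rewrite (_ : (r * t ^+ 2 <= r) = (t ^+ 2 <= 1))// -{2}[r]mulr1 ler_pM2l.
rewrite gt0_integralTZl ?exprn_gt0//; last by move=> x; rewrite lee_fin.
rewrite [X in (_ * (_ * (_ * X)))%E]IE -!EFinM; congr EFin.
by rewrite exprS mulr1; ring.
Qed.

End balls.

(** * Rotation invariance *)

Section plane_rotation.
Context {R : realType}.
Local Notation mu := (@lebesgue_measure R).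
Local Notation RR := (measurableTypeR R * measurableTypeR R)%type.
Implicit Type F : RR -> \bar R.

Lemma measurable_pair_affine (a b c d : R) :
  measurable_fun setT ((fun x => (a * x.1 + b * x.2, c * x.1 + d * x.2)) : RR -> RR).
Proof.
apply: measurable_fun_pair; apply: measurable_funD; apply: measurable_funM => //.
Qed.

Let measurable_snd F (x : R) : measurable_fun setT F ->
  measurable_fun setT (fun y => F (x, y)).
Proof. by move=> mF; apply: measurableT_comp => //; exact: measurable_fun_pair. Qed.

Let measurable_fst F (y : R) : measurable_fun setT F ->
  measurable_fun setT (fun x => F (x, y)).
Proof. by move=> mF; apply: measurableT_comp => //; exact: measurable_fun_pair. Qed.

Lemma integral2C F : measurable_fun setT F -> (forall x, 0 <= F x)%E ->
  (\int[mu]_s \int[mu]_t F (s, t) = \int[mu]_t \int[mu]_s F (s, t))%E.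
Proof.
move=> mF F0.
exact: (@fubini_tonelli _ _ (measurableTypeR R) (measurableTypeR R) R mu mu F).
Qed.

Lemma measurable_integral_snd F : measurable_fun setT F -> (forall x, 0 <= F x)%E ->
  measurable_fun setT (fun s : measurableTypeR R => \int[mu]_t F (s, t))%E.
Proof.
move=> mF F0.
exact: (@measurable_fun_fubini_tonelli_F _ _ (measurableTypeR R)
  (measurableTypeR R) R mu F).
Qed.

Lemma integral2_shearr F (a : R) : measurable_fun setT F -> (forall x, 0 <= F x)%E ->
  (\int[mu]_s \int[mu]_t F (s, a * s + t)%R = \int[mu]_s \int[mu]_t F (s, t))%E.
Proof.
move=> mF F0; apply: eq_integral => s _.
rewrite [RHS](@ge0_integral_affine _ 1 (a * s))//; last exact: measurable_snd.
by rewrite normr1 mul1e; apply: eq_integral => t _; rewrite mul1r addrC.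
Qed.

Lemma integral2_shearl F (a : R) : measurable_fun setT F -> (forall x, 0 <= F x)%E ->
  (\int[mu]_s \int[mu]_t F (s + a * t, t)%R = \int[mu]_s \int[mu]_t F (s, t))%E.
Proof.
move=> mF F0.
have mF' : measurable_fun setT ((fun x => F (x.1 + a * x.2, x.2)) : RR -> \bar R).
  apply: measurableT_comp => //; apply: measurable_fun_pair => //.
  by apply: measurable_funD => //; exact: measurable_funM.
transitivity (\int[mu]_t \int[mu]_s F (s + a * t, t)%R)%E.
  exact: (integral2C (fun x => F (x.1 + a * x.2, x.2)) mF').
apply: etrans (esym (integral2C F mF F0)).
apply: eq_integral => t _.
rewrite [RHS](@ge0_integral_affine _ 1 (a * t))//; last exact: measurable_fst.
by rewrite normr1 mul1e; apply: eq_integral => s _; rewrite mul1r.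
Qed.

(* A rotation is a product of three shears. *)
Lemma integral2_rotation F (c d : R) : measurable_fun setT F ->
  (forall x, 0 <= F x)%E -> c ^+ 2 + d ^+ 2 = 1 ->
  (\int[mu]_s \int[mu]_t F (c * s - d * t, d * s + c * t)%R =
   \int[mu]_s \int[mu]_t F (s, t))%E.
Proof.
move=> mF F0 cd1.
have mFlin a1 a2 b1 b2 : measurable_fun setT
    ((fun x => F (a1 * x.1 + a2 * x.2, b1 * x.1 + b2 * x.2)) : RR -> \bar R).
  by apply: measurableT_comp => //; exact: measurable_pair_affine.
(* If d = 0 the map is plus or minus the identity, and the shear parameter used below is
   undefined. *)
have [d0|d0] := eqVneq d 0.
  have c1 : `|c| = 1.
    by apply/eqP; rewrite -sqr_norm_eq1; apply/eqP; rewrite -cd1 d0 expr0n addr0.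
  have c0 : c != 0 by rewrite -normr_eq0 c1 oner_neq0.
  have mFs s : measurable_fun setT (fun t => F (c * s, t)) by exact: measurable_snd.
  rewrite [RHS](@ge0_integral_affine _ c 0)//; last 2 first.
  - exact: measurable_integral_snd.
  - by move=> s; exact: integral_ge0.
  rewrite c1 mul1e; apply: eq_integral => s _.
  rewrite [RHS](@ge0_integral_affine _ c 0)//; last exact: measurable_snd.
  rewrite c1 mul1e; apply: eq_integral => t _.
  by rewrite d0 !mul0r !addr0 subr0 add0r.
(* For c = cos(theta) and d = sin(theta) this is -tan(theta/2), the parameter of both outer shears;
   the middle shear has parameter d. *)
pose a := (c - 1) / d.
apply: etrans (integral2_shearl F a mF F0).
pose F1 : RR -> \bar R := fun x => F (x.1 + a * x.2, x.2).
have mF1 : measurable_fun setT F1.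
  rewrite (_ : F1 = fun x => F (1 * x.1 + a * x.2, 0 * x.1 + 1 * x.2))//.
  by apply/funext => x; rewrite !mul1r mul0r add0r.
apply: etrans (integral2_shearr F1 d mF1 (fun=> F0 _)).
pose F2 : RR -> \bar R := fun x => F1 (x.1, d * x.1 + x.2).
have mF2 : measurable_fun setT F2.
  rewrite (_ : F2 = fun x => F ((1 + a * d) * x.1 + a * x.2, d * x.1 + 1 * x.2))//.
  by apply/funext => x; rewrite /F2 /F1 /= mul1r; congr (F (_, _)); ring.
apply: etrans (integral2_shearl F2 a mF2 (fun=> F0 _)).
apply: eq_integral => s _; apply: eq_integral => t _; rewrite /F2 /F1 /=.
have ad : a * d = c - 1 by rewrite /a mulfVK.
have ac : a * (c + 1) = - d.
  by rewrite /a mulrAC -subr_sqr expr1n -cd1 opprD addrA subrr sub0r expr2 mulNr mulfK.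
rewrite (_ : s + a * t + a * _ = (1 + a * d) * s + a * (a * d + 2) * t); last by ring.
rewrite (_ : d * (s + a * t) + t = d * s + (1 + a * d) * t); last by ring.
rewrite ad (_ : c - 1 + 2 = c + 1); last by ring.
by rewrite ac mulNr [1 + _]addrC subrK.
Qed.

End plane_rotation.

Section iint_rotation.
Context {R : realType}.
Local Notation mu := (@lebesgue_measure R).
Local Notation RR := (measurableTypeR R * measurableTypeR R)%type.
Implicit Type F : RR -> \bar R.

Lemma linear_row_mx m (p : 'I_m.+1 -> R) (t : R) (y : 'rV[R]_m) :
  \sum_i (row_mx t%:M y : 'rV_m.+1) ord0 i * p i =
  p ord0 * t + \sum_i y ord0 i * p (lift ord0 i).
Proof.
rewrite big_ord_recl row_mx_head [t * _]mulrC; congr (_ + _).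
by apply: eq_bigr => i _; rewrite row_mx_tail.
Qed.

(** Supplies the measurability of the partially integrated function that the plane rotation in
    [iint_rotation] requires. The induction absorbs the square of each integrated coordinate into
    the second argument. *)
Lemma measurable_iint_radial m F : measurable_fun setT F -> (forall x, 0 <= F x)%E ->
  measurable_fun setT
    ((fun x => iint (fun z : 'rV[R]_m => F (x.1, x.2 + sqnorm z))) : RR -> \bar R).
Proof.
move=> mF F0; elim: m => [|m IHm] /=.
  rewrite (_ : (fun _ => _) = F)//; apply/funext => -[u w] /=.
  by rewrite /sqnorm big_ord0 addr0.
pose G : RR -> \bar R := fun x => iint (fun z : 'rV[R]_m => F (x.1, x.2 + sqnorm z)).
have G0 x : (0 <= G x)%E by exact: iint_ge0.
pose H : (RR * measurableTypeR R)%type -> \bar R := fun x => G (x.1.1, x.1.2 + x.2 ^+ 2).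
have mH : measurable_fun setT H.
  apply: measurableT_comp => //; apply: measurable_fun_pair; first exact: measurableT_comp.
  by apply: measurable_funD; [exact: measurableT_comp|exact: measurable_funX].
rewrite (_ : (fun _ => _) = (fun x => \int[mu]_t H (x, t))%E).
  exact: (@measurable_fun_fubini_tonelli_F _ _ RR (measurableTypeR R) R mu
    H mH (fun=> G0 _)).
apply/funext => x; apply: eq_integral => t _; apply: eq_iint => z.
by rewrite sqnorm_row_mx addrA.
Qed.

(** Rotates p onto a coordinate axis, so that s is the coordinate along p. The induction hypothesis
    rotates the tail of p, of length q, onto one axis; a plane rotation then takes (p_0, q) to (r,
    0). *)
Lemma iint_rotation m (p : 'I_m.+1 -> R) F :
  measurable_fun setT F -> (forall x, 0 <= F x)%E ->
  iint (fun y : 'rV[R]_m.+1 => F (\sum_i y ord0 i * p i, sqnorm y)) =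
  (\int[mu]_s iint (fun z : 'rV[R]_m =>
     F (Num.sqrt (\sum_i p i ^+ 2) * s, s ^+ 2 + sqnorm z)%R))%E.
Proof.
elim: m p F => [|m IHm] p F mF F0.
  rewrite /= big_ord1 sqrtr_sqr.
  under eq_integral do rewrite linear_row_mx sqnorm_row_mx big_ord0 addr0.
  have [p0|p0] := leP 0 (p ord0); first by rewrite ger0_norm.
  rewrite ltr0_norm// [LHS](@ge0_integral_affine _ (-1) 0) ?oppr_eq0 ?oner_eq0//; last first.
    apply: measurableT_comp => //; apply: measurable_fun_pair.
      exact: measurable_funM.
    by apply: measurable_funD => //; exact: measurable_funX.
  rewrite normrN1 mul1e; apply: eq_integral => s _.
  by rewrite addr0 mulN1r mulrN mulNr sqrrN.
pose q := Num.sqrt (\sum_i p (lift ord0 i) ^+ 2).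
pose r := Num.sqrt (\sum_i p i ^+ 2).
have r2 : r ^+ 2 = p ord0 ^+ 2 + q ^+ 2.
  have sum_ge0 n (f : 'I_n -> R) : 0 <= \sum_i f i ^+ 2.
    by apply: sumr_ge0 => i _; exact: sqr_ge0.
  by rewrite /r /q !sqr_sqrtr ?sum_ge0// big_ord_recl.
pose G : RR -> \bar R := fun x => iint (fun z : 'rV[R]_m => F (x.1, x.2 + sqnorm z)).
have G0 x : (0 <= G x)%E by exact: iint_ge0.
have mG : measurable_fun setT G by exact: measurable_iint_radial.
transitivity (\int[mu]_t iint (fun y : 'rV[R]_m.+1 =>
    F (\sum_i (row_mx t%:M y : 'rV_m.+2) ord0 i * p i,
       @sqnorm R m.+2 (row_mx t%:M y))%R))%E; first by [].
transitivity (\int[mu]_t \int[mu]_s G (p ord0 * t + q * s, t ^+ 2 + s ^+ 2)%R)%E.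
  apply: eq_integral => t _.
  pose Ft : RR -> \bar R := fun x => F (p ord0 * t + x.1, t ^+ 2 + x.2).
  transitivity (iint (fun y : 'rV[R]_m.+1 =>
      Ft (\sum_i y ord0 i * p (lift ord0 i), sqnorm y))).
    by apply: eq_iint => y; rewrite linear_row_mx sqnorm_row_mx.
  rewrite (IHm (fun i => p (lift ord0 i)) Ft) => [||x]; last exact: F0.
    apply: eq_integral => s _; apply: eq_iint => z.
    by rewrite /Ft /= addrA.
  apply: measurableT_comp => //; apply: measurable_fun_pair;
    by apply: measurable_funD.
transitivity (\int[mu]_t \int[mu]_s G (r * t, t ^+ 2 + s ^+ 2)%R)%E; last first.
  apply: eq_integral => t _; apply: eq_integral => s _; apply: eq_iint => z.
  by rewrite sqnorm_row_mx addrA.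
have [r0|r0] := eqVneq r 0.
  have [-> ->] : p ord0 = 0 /\ q = 0.
    move: r2; rewrite r0 expr0n => /esym/eqP.
    by rewrite paddr_eq0 ?sqr_ge0// !sqrf_eq0 => /andP[/eqP-> /eqP->].
  rewrite r0.
  by apply: eq_integral => t _; apply: eq_integral => s _; rewrite !mul0r addr0.
pose Phi : RR -> \bar R := fun x => G (r * x.1, x.1 ^+ 2 + x.2 ^+ 2).
have mPhi : measurable_fun setT Phi.
  apply: measurableT_comp => //; apply: measurable_fun_pair.
    exact: measurable_funM.
  by apply: measurable_funD; exact: measurable_funX.
(* The rotation with cosine p_0/r and sine -q/r turns r t into p_0 t + q s. *)
have cd1 : (p ord0 / r) ^+ 2 + (- (q / r)) ^+ 2 = 1.
  by rewrite sqrrN !exprMn -mulrDl -r2 exprVn divff// sqrf_eq0.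
apply: etrans (integral2_rotation Phi _ _ mPhi (fun=> G0 _) cd1).
apply: eq_integral => t _; apply: eq_integral => s _; rewrite /Phi /=.
congr (G (_, _)); first by field.
by rewrite -[LHS]mul1r -cd1; field.
Qed.

End iint_rotation.

(** * Sections of truncated ellipsoids *)

Section truncated_ellipsoid.
Context {R : realType}.
Local Notation mu := (@lebesgue_measure R).
Local Notation RR := (measurableTypeR R * measurableTypeR R)%type.

(* The ellipsoid of revolution |x'|^2 + B x_0^2 <= A cut by the slab
   |x_0| <= H, where x = (x_0, x'). *)
Definition trunc_ellipsoid {n : nat} (A B H : R) : set 'rV[R]_n.+1 :=
  [set x : 'rV[R]_n.+1 | (`|x ord0 ord0| <= H) &&
           (sqnorm x + (B - 1) * x ord0 ord0 ^+ 2 <= A)].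

Lemma indic_trunc_ellipsoid A B H n (x : 'rV[R]_n.+1) :
  \1_(trunc_ellipsoid A B H) x =
  ((`|x ord0 ord0| <= H) && (sqnorm x + (B - 1) * x ord0 ord0 ^+ 2 <= A))%R%:R :> R.
Proof.
by rewrite indicE; congr ((nat_of_bool _)%:R); apply/idP/idP; rewrite inE.
Qed.

(** Here s is the coordinate in the hyperplane along the projection of the axis, and rho is the
    length of the projected unit axis vector, so x_0 = rho s. What stands under the root is the
    squared radius of the k-dimensional slice at s. *)
Definition section_profile k (A B H rho s : R) : R :=
  (`|rho * s| <= H)%R%:R *
  Num.sqrt (A - B * (rho * s) ^+ 2 - (1 - rho ^+ 2) * s ^+ 2) ^+ k.

Definition section_integral k (A B H rho : R) : \bar R :=
  (\int[mu]_s (section_profile k A B H rho s)%:E)%E.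

Lemma section_profile_ge0 k A B H rho s : 0 <= section_profile k A B H rho s.
Proof. by rewrite mulr_ge0// exprn_ge0// sqrtr_ge0. Qed.

Lemma measurable_section_profile k A B H rho :
  measurable_fun setT (section_profile k A B H rho).
Proof.
apply: measurable_funM.
  apply/measurable_fun_bool_natr/measurable_fun_ler => //.
  by apply: measurableT_comp => //; exact: measurable_funM.
apply/measurable_funX/measurable_fun_sqrt; apply: measurable_funB.
  apply: measurable_funB => //; apply: measurable_funM => //.
  by apply: measurable_funX; exact: measurable_funM.
by apply: measurable_funM => //; exact: measurable_funX.
Qed.

Lemma section_integral_scale k (c A B H rho : R) : 0 < c ->
  section_integral k (c ^+ 2 * A) B (c * H) rho =
  ((c ^+ k.+1)%:E * section_integral k A B H rho)%E.
Proof.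
move=> c0; rewrite /section_integral.
rewrite (@ge0_integral_affine _ c 0); last 3 first.
- by rewrite gt_eqF.
- by apply/measurable_EFinP; exact: measurable_section_profile.
- by move=> s; rewrite lee_fin section_profile_ge0.
transitivity (c%:E * \int[mu]_s ((c ^+ k)%:E * (section_profile k A B H rho s)%:E))%E.
  rewrite gtr0_norm//; congr (_ * _)%E; apply: eq_integral => s _.
  rewrite -EFinM; congr EFin; rewrite /section_profile addr0 mulrCA normrM gtr0_norm//.
  rewrite ler_pM2l// [RHS]mulrCA; congr (_ * _).
  rewrite -[c in RHS]gtr0_norm// -[`|c|]sqrtr_sqr -exprMn -sqrtrM ?sqr_ge0//.
  by congr (Num.sqrt _ ^+ _); ring.
rewrite gt0_integralTZl ?exprn_gt0//; last first.
  by move=> s; rewrite lee_fin section_profile_ge0.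
by rewrite muleA -EFinM -exprS.
Qed.

Let iint_slice m (kappa : R) (A u w H : R) : (0 < m)%N ->
  (forall r, iint (fun z : 'rV[R]_m => (sqnorm z <= r)%R%:R%:E) =
            (kappa * (Num.sqrt r ^+ m * (0 <= r)%R%:R))%:E) ->
  iint (fun z : 'rV[R]_m => ((`|u| <= H) && (w + sqnorm z <= A))%R%:R%:E) =
  (kappa%:E * ((`|u| <= H)%R%:R * Num.sqrt (A - w) ^+ m)%:E)%E.
Proof.
move=> m0 ball; have [uH|uH] /= := boolP (`|u| <= H); last first.
  by rewrite mul0r mule0; exact: iint0.
rewrite mul1r -EFinM (@eq_iint _ _ _ (fun z => (sqnorm z <= A - w)%R%:R%:E)).
  rewrite ball; have [Aw|Aw] := leP 0 (A - w); first by rewrite mulr1.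
  (* On an empty slice the root is 0 by convention, and so is its power because m > 0. *)
  by rewrite ltr0_sqrtr// expr0n gtn_eqF// !mulr0.
by move=> z; rewrite lerBrDl.
Qed.

(** Slicing by x_0 itself is the case rho = 1 with slices of dimension k + 1, so volumes and
    sections share one formula. *)
Lemma iint_trunc_ellipsoid k : exists2 kappa : R, 0 < kappa & forall A B H,
  iint (fun x : 'rV[R]_k.+2 => (\1_(trunc_ellipsoid A B H) x)%:E) =
  (kappa%:E * section_integral k.+1 A B H 1)%E.
Proof.
have [kappa kappa0 ball] := @iint_ball R k.+1.
exists kappa => // A B H; rewrite iintS /section_integral -gt0_integralTZl//; last first.
  by move=> s; rewrite lee_fin section_profile_ge0.
apply: eq_integral => t _.
transitivity (iint (fun z : 'rV[R]_k.+1 =>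
    ((`|t| <= H) && (B * t ^+ 2 + sqnorm z <= A))%R%:R%:E)).
  apply: eq_iint => z; rewrite indic_trunc_ellipsoid row_mx_head sqnorm_row_mx.
  by rewrite (_ : t ^+ 2 + _ + _ = B * t ^+ 2 + sqnorm z)//; ring.
rewrite (iint_slice _ _ _ _ _ _ _ ball)// /section_profile mul1r expr1n subrr mul0r subr0.
by [].
Qed.

(** The value of rho is the length of the first column of P. It depends on P alone, and kappa on
    neither P nor the body, so two bodies can be compared section by section through the same
    rho. *)
Lemma iint_section_trunc_ellipsoid k : (0 < k)%N ->
  exists2 kappa : R, 0 < kappa & forall P : 'M[R]_(k.+1, k.+2),
  P *m P^T = 1%:M -> exists2 rho : R, 0 <= rho <= 1 & forall A B H,
  iint (fun y : 'rV[R]_k.+1 => (\1_(trunc_ellipsoid A B H) (y *m P))%:E) =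
  (kappa%:E * section_integral k A B H rho)%E.
Proof.
move=> k0; have [kappa kappa0 ball] := @iint_ball R k.
exists kappa => // P PP1.
have P_ge0 : 0 <= \sum_i P i ord0 ^+ 2 by apply: sumr_ge0 => i _; exact: sqr_ge0.
exists (Num.sqrt (\sum_i P i ord0 ^+ 2)).
  rewrite sqrtr_ge0/= -sqrtr1 ler_wsqrtr//.
  (* P^T P is an orthogonal projection, so its diagonal entries are at least
     their squares. *)
  set a := \sum_i _.
  have aE : a = (P^T *m P) ord0 ord0.
    by rewrite mxE; apply: eq_bigr => i _; rewrite mxE expr2.
  have a2 : a ^+ 2 <= a.
    have MM : P^T *m P *m (P^T *m P) = P^T *m P.
      by rewrite mulmxA -(mulmxA P^T) PP1 mulmx1.
    have MT i j : (P^T *m P) i j = (P^T *m P) j i.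
      by rewrite !mxE; apply: eq_bigr => l _; rewrite !mxE mulrC.
    rewrite [leRHS]aE -MM mxE big_ord_recl -aE -expr2 lerDl.
    by apply: sumr_ge0 => j _; rewrite [X in _ * X]MT -expr2 sqr_ge0.
  have a_ge0 : 0 <= a by [].
  nra.
move=> A B H; set rho := Num.sqrt _.
pose F : RR -> \bar R :=
  fun x => ((`|x.1| <= H) && (x.2 + (B - 1) * x.1 ^+ 2 <= A))%R%:R%:E.
have mF : measurable_fun setT F.
  apply/measurable_EFinP/measurable_fun_bool_natr/measurable_and.
    by apply: measurable_fun_ler => //; exact: measurableT_comp.
  apply: measurable_fun_ler => //; apply: measurable_funD => //.
  by apply: measurable_funM => //; exact: measurable_funX.
transitivity (iint (fun y : 'rV[R]_k.+1 => F (\sum_i y ord0 i * P i ord0, sqnorm y))).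
  apply: eq_iint => y; rewrite indic_trunc_ellipsoid.
  have -> : sqnorm (y *m P) = sqnorm y.
    have sqnormE m (x : 'rV[R]_m) : sqnorm x = (x *m x^T) ord0 ord0.
      by rewrite mxE; apply: eq_bigr => i _; rewrite mxE expr2.
    by rewrite !sqnormE trmx_mul mulmxA -(mulmxA y) PP1 mulmx1.
  by rewrite mxE.
rewrite iint_rotation//; last by move=> x; rewrite lee_fin.
rewrite /section_integral -gt0_integralTZl//; last first.
  by move=> s; rewrite lee_fin section_profile_ge0.
apply: eq_integral => s _.
transitivity (iint (fun z : 'rV[R]_k =>
    ((`|rho * s| <= H) && (s ^+ 2 + (B - 1) * (rho * s) ^+ 2 + sqnorm z <= A))%R%:R%:E)).
  by apply: eq_iint => z; rewrite /F /= addrAC.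
rewrite (iint_slice _ _ _ _ _ _ _ ball)// /section_profile.
by congr (_ * (_ * Num.sqrt _ ^+ _)%:E)%E; ring.
Qed.

End truncated_ellipsoid.

(** * The Euclidean counterexample *)

Section elementary_inequalities.
Context {R : realType}.

(** The tangent at u = q^2 of the convex function u^((j+2)/2), evaluated at u = p^2; in terms of p
    and q, induction on j replaces fractional powers. *)
Lemma expr_sqr_tangent j (p q : R) : 0 <= p -> 0 <= q ->
  q ^+ j.+2 + j.+2%:R / 2 * q ^+ j * (p ^+ 2 - q ^+ 2) <= p ^+ j.+2.
Proof.
move=> p0 q0; elim: j => [|j IHj].
  by rewrite expr0 divff// !mul1r addrC subrK.
(* Since p^(j+3) = q p^(j+2) + p^(j+2) (p - q), this provides the 1/2 by which the coefficient grows
   from j to j + 1. *)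
have step : q ^+ j.+1 * ((p + q) / 2) * (p - q) <= p ^+ j.+2 * (p - q).
  have [pq|pq] := leP q p.
    rewrite ler_wpM2r ?subr_ge0// [p ^+ _]exprSr.
    by apply: ler_pM; rewrite ?exprn_ge0// ?lerXn2r//; lra.
  rewrite ler_wnM2r ?subr_le0 ?(ltW pq)// [p ^+ _]exprSr.
  by apply: ler_pM; rewrite ?exprn_ge0// ?lerXn2r// ?ltW//; lra.
have IHq : q * (q ^+ j.+2 + j.+2%:R / 2 * q ^+ j * (p ^+ 2 - q ^+ 2)) <= q * p ^+ j.+2.
  by rewrite ler_wpM2l.
apply: le_trans (_ : q * p ^+ j.+2 + p ^+ j.+2 * (p - q) <= _); last first.
  by rewrite mulrBr addrC -exprSr mulrC subrK.
apply: le_trans (lerD IHq step).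
rewrite le_eqVlt; apply/orP; left; apply/eqP.
by rewrite -(natr1 j.+2) [q ^+ j.+3]exprS [q ^+ j.+1]exprS; field.
Qed.

(** The truncation of the root at 0 acts in the right direction: its square is at least u + y. *)
Lemma sqrt_expr_tangent j (u y : R) : 0 <= u ->
  Num.sqrt u ^+ j.+2 + j.+2%:R / 2 * Num.sqrt u ^+ j * y <=
  Num.sqrt (u + y) ^+ j.+2.
Proof.
move=> u0; apply: le_trans (expr_sqr_tangent j _ _ (sqrtr_ge0 (u + y)) (sqrtr_ge0 u)).
rewrite lerD2l ler_wpM2l ?mulr_ge0 ?exprn_ge0 ?sqrtr_ge0//.
rewrite (sqr_sqrtr u0); have [uy|uy] := leP 0 (u + y).
  by rewrite sqr_sqrtr//; lra.
by rewrite ltr0_sqrtr// expr0n/=; lra.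
Qed.

Lemma bernoulli_ge k (d : R) : 0 <= d <= 1 -> 1 - k%:R * d <= (1 - d) ^+ k.
Proof.
move=> /andP[d0 d1]; elim: k => [|k IHk]; first by rewrite mul0r subr0 expr0.
rewrite exprS; apply: le_trans (_ : (1 - d) * (1 - k%:R * d) <= _); last first.
  by rewrite ler_wpM2l// subr_ge0.
rewrite -natr1; have : 0 <= k%:R * d ^+ 2 :> R by rewrite mulr_ge0// sqr_ge0.
nra.
Qed.

(** From (1 + z)^k (1 - z)^k <= 1 and Bernoulli's inequality for 1 - z, the left side is at most
    1/(1 - y) with y = k z, and (1 - y)(1 + y + 2 y^2) = 1 + y^2 (1 - 2 y). *)
Lemma bernoulli_le k (z : R) : `|z| <= 1 -> `|k%:R * z| <= 2^-1 ->
  (1 + z) ^+ k <= 1 + k%:R * z + 2 * (k%:R * z) ^+ 2.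
Proof.
rewrite !ler_norml => /andP[z1 z2] /andP[kz1 kz2].
have pz : (1 + z) ^+ k * (1 - k%:R * z) <= 1.
  have [z0|z0] := leP 0 z.
    apply: le_trans (_ : (1 + z) ^+ k * (1 - z) ^+ k <= 1).
      by rewrite ler_wpM2l ?exprn_ge0 ?bernoulli_ge//; lra.
    by rewrite -exprMn exprn_ile1//; nra.
  have b : 1 - k%:R * z <= (1 - z) ^+ k.
    elim: (k) => [|m IHm]; first by rewrite mul0r subr0 expr0.
    rewrite exprS; apply: le_trans (_ : (1 - z) * (1 - m%:R * z) <= _); last first.
      by rewrite ler_wpM2l//; lra.
    rewrite -natr1; have : 0 <= m%:R * z ^+ 2 :> R by rewrite mulr_ge0// sqr_ge0.
    nra.
  apply: le_trans (_ : (1 + z) ^+ k * (1 - z) ^+ k <= 1).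
    by rewrite ler_wpM2l ?exprn_ge0//; lra.
  by rewrite -exprMn exprn_ile1//; nra.
set y := k%:R * z in kz1 kz2 pz *.
have y1 : 0 < 1 - y by lra.
rewrite -(ler_pM2r y1) (le_trans pz)//; nra.
Qed.

(** Strictness in Chebyshev's inequality, uniform for t away from 0: the weight drops by a definite
    amount from v = 1/3, the zero of 1 - 3v, to v = 9/16, where 3v - 1 = 11/16. The exponent is
    positive, and it will be k - 2; this is where n > 4 enters. *)
Lemma sqrt_gap j (t0 : R) : 0 < t0 -> exists2 c : R, 0 < c & forall t, t0 <= t <= 1 ->
  c <= 11 / 16 * (Num.sqrt (1 - t / 3) ^+ j.+1 - Num.sqrt (1 - 9 / 16 * t) ^+ j.+1).
Proof.
move=> t00; exists (11 / 16 * (11 / 96 * t0 * (2 / 3) ^+ j)).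
  by rewrite !mulr_gt0// exprn_gt0; lra.
move=> t /andP[t0t t1]; rewrite ler_pM2l; last lra.
set U := Num.sqrt _; set V := Num.sqrt _.
have U0 : 0 <= U by exact: sqrtr_ge0.
have V0 : 0 <= V by exact: sqrtr_ge0.
have U2 : U ^+ 2 = 1 - t / 3 by rewrite sqr_sqrtr//; lra.
have V2 : V ^+ 2 = 1 - 9 / 16 * t by rewrite sqr_sqrtr//; lra.
have UV : V <= U by rewrite ler_wsqrtr//; lra.
have U23 : 2 / 3 <= U by nra.
have U1 : U <= 1 by nra.
(* Here U^2 - V^2 = 11 t / 48 and U + V <= 2. *)
have gap : 11 / 96 * t0 <= U - V by nra.
apply: le_trans (_ : (U - V) * U ^+ j <= _).
  by apply: ler_pM; rewrite ?exprn_ge0// ?lerXn2r ?nnegrE//; lra.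
by rewrite mulrBl -!exprS lerB// exprS ler_wpM2l// lerXn2r.
Qed.

(* Both factors of w(v) (1 - 3 v^2), where w(v) = sqrt (1 - t v^2) ^ j.+1,
   decrease in v^2 and the second one vanishes at v^2 = 1/3. *)
Lemma chebyshev_pointwise j (t v c : R) : 0 <= t <= 1 -> v <= 1 -> 0 <= v ->
  c <= 11 / 16 * (Num.sqrt (1 - t / 3) ^+ j - Num.sqrt (1 - 9 / 16 * t) ^+ j) ->
  Num.sqrt (1 - t / 3) ^+ j * (1 - 3 * v) + c * (9 / 16 <= v)%R%:R <=
  Num.sqrt (1 - t * v) ^+ j * (1 - 3 * v).
Proof.
move=> /andP[t0 t1] v1 v0; set W := fun x => Num.sqrt (1 - t * x) ^+ j.
have W0 x : 0 <= W x by rewrite exprn_ge0// sqrtr_ge0.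
have Wle x y : x <= y -> W y <= W x.
  move=> xy; rewrite lerXn2r ?nnegrE ?sqrtr_ge0// ler_wsqrtr//; nra.
have -> : Num.sqrt (1 - t / 3) ^+ j = W (3^-1) by [].
have -> : Num.sqrt (1 - 9 / 16 * t) ^+ j = W (9 / 16) by rewrite /W [t * _]mulrC.
rewrite -/(W v) => hc.
(* Beyond 9/16 the excess is (3v - 1)(W(1/3) - W(v)), with first factor at least 11/16; this pays
   for c. *)
have [v916|v916] := leP (9 / 16) v.
  rewrite mulr1; have := Wle _ _ v916; have := Wle 3^-1 (9 / 16).
  have : 3^-1 <= 9 / 16 :> R by lra.
  move=> /[swap] /[apply]; nra.
rewrite mulr0 addr0; have [v3|v3] := leP v 3^-1.
  by have := Wle _ _ v3; nra.
by have := Wle _ _ (ltW v3); nra.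
Qed.

End elementary_inequalities.

(** * Integrals of profiles over slabs *)

Section profiles.
Context {R : realType}.
Local Notation mu := (@lebesgue_measure R).

Lemma measurable_itv_natr (i : interval R) :
  measurable_fun setT (fun x : R => (x \in i)%:R : R).
Proof.
apply: measurable_fun_bool_natr; apply: (measurable_fun_bool true).
by rewrite setTI [X in measurable X](_ : _ = [set` i]).
Qed.

Lemma integral_itv (i : interval R) :
  (\int[mu]_x (x \in i)%:R%:E = mu [set` i])%E.
Proof.
transitivity (\int[mu]_x (\1_([set` i]) x)%:E)%E.
  by apply: eq_integral => x _; rewrite indicE mem_setE.
by rewrite integral_indic// setIT.
Qed.

Lemma integral_sqr (h : R) : 0 < h ->
  (\int[mu]_x ((x \in `[- h, h])%:R * x ^+ 2)%:E = (2 / 3 * h ^+ 3)%:E)%E.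
Proof.
move=> h0; transitivity (\int[mu]_(x in `[(- h)%R, h]) (x ^+ 2)%:E)%E.
  rewrite [RHS]integral_mkcond; apply: eq_integral => x _.
  by rewrite /patch mem_setE; case: ifP => _; rewrite (mul1r, mul0r).
have dF (x : R) : is_derive x 1 (fun y : R => y ^+ 3 / 3 : R) (x ^+ 2).
  rewrite (_ : (fun y => _) = 3^-1 *: ((@id R) ^+ 3)); last first.
    by apply/funext => y; rewrite mulrC.
  apply: is_derive_eq; rewrite scaler1 -[_ *: _]/(3^-1 * (3 * x ^+ 2)).
  by field.
have cF : continuous (fun y : R => y ^+ 3 / 3 : R).
  move=> x; apply/differentiable_continuous/derivable1_diffP.
  by have [] := dF x.
rewrite (@continuous_FTC2 _ _ (fun x => x ^+ 3 / 3)).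
- by rewrite -EFinB; congr EFin; field.
- lra.
- by apply: continuous_subspaceT => x; exact: exprn_continuous.
- split => [x _||]; first by have [] := dF x.
    by apply: cvg_at_right_filter; exact: cF.
  by apply: cvg_at_left_filter; exact: cF.
- by move=> x _; rewrite derive1E; have [] := dF x.
Qed.

Lemma ge0_integralDT (f g : R -> R) :
  measurable_fun setT f -> measurable_fun setT g ->
  (forall x, 0 <= f x) -> (forall x, 0 <= g x) ->
  (\int[mu]_x (f x + g x)%:E = \int[mu]_x (f x)%:E + \int[mu]_x (g x)%:E)%E.
Proof.
move=> mf mg f0 g0; under eq_integral do rewrite EFinD.
by apply: ge0_integralD => //; [move=> x _; rewrite lee_fin|
  exact/measurable_EFinP|move=> x _; rewrite lee_fin|exact/measurable_EFinP].
Qed.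

Lemma ge0_integralZT (c : R) (f : R -> R) : measurable_fun setT f ->
  0 <= c -> (forall x, 0 <= f x) ->
  (\int[mu]_x (c * f x)%:E = c%:E * \int[mu]_x (f x)%:E)%E.
Proof.
move=> mf c0 f0; under eq_integral do rewrite EFinM.
by apply: ge0_integralZl => //; [exact/measurable_EFinP|move=> x _; rewrite lee_fin].
Qed.

(* Radius squared [A - C s^2] over the slab [|s| <= H]. *)
Definition profile k (A C H s : R) : R :=
  (s \in `[- H, H])%:R * Num.sqrt (A - C * s ^+ 2) ^+ k.

Definition profile_integral k (A C H : R) : \bar R :=
  (\int[mu]_s (profile k A C H s)%:E)%E.

Lemma profile_ge0 k A C H s : 0 <= profile k A C H s.
Proof. by rewrite mulr_ge0// exprn_ge0// sqrtr_ge0. Qed.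

Lemma measurable_profile k A C H : measurable_fun setT (profile k A C H).
Proof.
apply: measurable_funM; first exact: measurable_itv_natr.
apply/measurable_funX/measurable_fun_sqrt/measurable_funB => //.
by apply: measurable_funM => //; exact: measurable_funX.
Qed.

(** Negative terms of the pointwise estimate have been moved across, so that only nonnegative
    functions are integrated. The intervals are [-1, 1], its parts with |x| >= 3/4, and the end
    slabs 1 < |x| <= H. *)
Lemma integral_le_sum (f g : R -> R) (p q q1 c th H : R) :
  measurable_fun setT f -> measurable_fun setT g ->
  (forall x, 0 <= f x) -> (forall x, 0 <= g x) ->
  0 <= p -> 0 <= q -> 0 <= q1 -> 0 <= c -> 0 <= th -> 1 <= H ->
  (forall x, f x + (q1 * (x \in `[-1, 1])%:R +
      (c * (x \in `[-1, - (3 / 4)])%:R + c * (x \in `[3 / 4, 1])%:R) +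
      (th * (x \in `[- H, -1[)%:R + th * (x \in `]1, H])%:R)) <=
    g x + (p * ((x \in `[-1, 1])%:R * x ^+ 2) + q * (x \in `[-1, 1])%:R)) ->
  (\int[mu]_x (f x)%:E + (2 * q1 + c / 2 + 2 * th * (H - 1))%:E <=
   \int[mu]_x (g x)%:E + (2 / 3 * p + 2 * q)%:E)%E.
Proof.
move=> mf mg f0 g0 p0 q0 q10 c0 th0 H1 fg.
have m2 : measurable_fun setT (fun x : R => (x \in `[-1, 1])%:R * x ^+ 2 : R).
  by apply: measurable_funM; [exact: measurable_itv_natr|exact: measurable_funX].
have mi := measurable_itv_natr.
have mZ (a : R) (i : interval R) : measurable_fun setT (fun x => a * (x \in i)%:R : R).
  by apply: measurable_funM.
have intZ (a : R) b1 b2 (x y : R) : 0 <= a -> x <= y ->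
    (\int[mu]_z (a * (z \in Interval (BSide b1 x) (BSide b2 y))%:R)%:E =
     (a * (y - x))%:E)%E.
  move=> a0 xy; rewrite ge0_integralZT// integral_itv lebesgue_measure_itv/= lte_fin.
  case: ltP => yx; first by rewrite -EFinB -EFinM.
  by rewrite (@le_anti _ _ x y) ?xy// subrr mulr0 mule0.
have Z0 (a : R) b : 0 <= a -> 0 <= a * b%:R by move=> a0; rewrite mulr_ge0.
have x20 (x : R) : 0 <= (x \in `[-1, 1])%:R * x ^+ 2 by rewrite mulr_ge0// sqr_ge0.
have mpx : measurable_fun setT (fun x : R => p * ((x \in `[-1, 1])%:R * x ^+ 2) : R).
  exact: measurable_funM.
have px0 x : 0 <= p * ((x \in `[-1, 1])%:R * x ^+ 2) by rewrite mulr_ge0.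
pose F x := q1 * (x \in `[-1, 1])%:R +
      (c * (x \in `[-1, - (3 / 4)])%:R + c * (x \in `[3 / 4, 1])%:R) +
      (th * (x \in `[- H, -1[)%:R + th * (x \in `]1, H])%:R).
pose G x := p * ((x \in `[-1, 1])%:R * x ^+ 2) + q * (x \in `[-1, 1])%:R.
have h0 : -1 <= 1 :> R by lra.
have intF : (\int[mu]_x (F x)%:E = (2 * q1 + c / 2 + 2 * th * (H - 1))%:E)%E.
  rewrite ge0_integralDT; [|by do ?apply: measurable_funD|exact: measurable_funD|
    by move=> x; rewrite !(addr_ge0, Z0)|by move=> x; rewrite !(addr_ge0, Z0)].
  rewrite ge0_integralDT; [|by []|exact: measurable_funD|
    by move=> x; rewrite Z0|by move=> x; rewrite !(addr_ge0, Z0)].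
  rewrite [X in (_ + X + _)%E]ge0_integralDT; [|by []|by []|
    by move=> x; rewrite Z0|by move=> x; rewrite Z0].
  rewrite [X in (_ + X)%E]ge0_integralDT; [|by []|by []|
    by move=> x; rewrite Z0|by move=> x; rewrite Z0].
  have h1 : -1 <= - (3 / 4) :> R by lra.
  have h2 : 3 / 4 <= 1 :> R by lra.
  have h3 : - H <= -1 by lra.
  rewrite !intZ//.
  by rewrite -!EFinD; congr EFin; field.
have intG : (\int[mu]_x (G x)%:E = (2 / 3 * p + 2 * q)%:E)%E.
  rewrite ge0_integralDT; [|by []|by []|by []|by move=> x; rewrite Z0].
  rewrite ge0_integralZT// integral_sqr// intZ//.
  by rewrite -EFinM -EFinD; congr EFin; field.
have mF : measurable_fun setT F by do ?apply: measurable_funD.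
have mG : measurable_fun setT G by exact: measurable_funD.
have F0 x : 0 <= F x by rewrite !(addr_ge0, Z0).
have G0 x : 0 <= G x by rewrite addr_ge0// Z0.
rewrite -intF -intG -!ge0_integralDT//.
apply: ge0_le_integralT => x; rewrite lee_fin; first exact: addr_ge0.
exact: fg.
Qed.

End profiles.

(** * First-order gain of the sections *)

Section cylinder_perturbation.
Context {R : realType}.
Local Notation mu := (@lebesgue_measure R).

(** The tangent inequality at the profile of the cylinder, followed by the pointwise Chebyshev
    bound; the term in b uses w <= 1. *)
Let gain_pointwise j (t e b c x : R) : 0 <= t <= 1 -> 0 <= e -> 0 <= b ->
  c <= 11 / 16 *
    (Num.sqrt (1 - t / 3) ^+ j.+1 - Num.sqrt (1 - 9 / 16 * t) ^+ j.+1) ->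
  x ^+ 2 <= 1 ->
  Num.sqrt (1 - t * x ^+ 2) ^+ j.+3 + j.+3%:R * e *
    (Num.sqrt (1 - t / 3) ^+ j.+1 * (1 - 3 * x ^+ 2) +
      c * (9 / 16 <= x ^+ 2)%R%:R - b) <=
  Num.sqrt (1 + 2 * e * (1 - b) - (6 * e + t) * x ^+ 2) ^+ j.+3.
Proof.
move=> t01 e0 b0 hc x1; have x0 := sqr_ge0 x; have /andP[t0 t1] := t01.
have u0 : 0 <= 1 - t * x ^+ 2 by nra.
have := sqrt_expr_tangent j.+1 _ (2 * e * (1 - b) - 6 * e * x ^+ 2) u0.
rewrite (_ : _ + (_ - _) = 1 + 2 * e * (1 - b) - (6 * e + t) * x ^+ 2); last by ring.
apply: le_trans; rewrite lerD2l.
set w := Num.sqrt (1 - t * x ^+ 2) ^+ j.+1.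
have w1 : w <= 1.
  by rewrite exprn_ile1 ?sqrtr_ge0// -[leRHS]sqrtr1 ler_wsqrtr//; nra.
have := chebyshev_pointwise _ _ _ _ t01 x1 x0 hc; rewrite -/w => cheb.
rewrite (_ : j.+3%:R / 2 * w * _ = j.+3%:R * e * (w * (1 - 3 * x ^+ 2) - w * b)).
  rewrite ler_wpM2l ?mulr_ge0// lerB// ler_piMl//.
by field.
Qed.

(** As 1 - 3x^2 has mean 0 on [-1, 1], only c, on a set of length 1/2, and b survive there; th
    bounds the profile from below on the end slabs. Large t will use c with th = 0, small t will use
    th with c = 0. *)
Lemma profile_integral_gain j (t e b c th H : R) :
  0 <= t <= 1 -> 0 <= e -> 0 <= b -> 0 <= c -> 0 <= th -> 1 <= H ->
  c <= 11 / 16 *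
    (Num.sqrt (1 - t / 3) ^+ j.+1 - Num.sqrt (1 - 9 / 16 * t) ^+ j.+1) ->
  (forall x, x ^+ 2 <= H ^+ 2 ->
    th <= Num.sqrt (1 + 2 * e * (1 - b) - (6 * e + t) * x ^+ 2) ^+ j.+3) ->
  (profile_integral j.+3 1 t 1 +
     (j.+3%:R * e * (c / 2 - 2 * b) + 2 * th * (H - 1))%:E <=
   profile_integral j.+3 (1 + 2 * e * (1 - b)) (6 * e + t) H)%E.
Proof.
move=> t01 e0 b0 c0 th0 H1 hc hth.
set ke := j.+3%:R * e; set w0 := Num.sqrt (1 - t / 3) ^+ j.+1 in hc *.
have ke0 : 0 <= ke by rewrite mulr_ge0.
have w00 : 0 <= w0 by rewrite exprn_ge0// sqrtr_ge0.
set A := 1 + _; set C := 6 * e + t.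
have := @integral_le_sum R (profile j.+3 1 t 1) (profile j.+3 A C H)
  (3 * (ke * w0)) (ke * b) (ke * w0) (ke * c) th H (measurable_profile _ _ _ _)
  (measurable_profile _ _ _ _) (profile_ge0 _ _ _ _) (profile_ge0 _ _ _ _).
have pt (x : R) : profile j.+3 1 t 1 x + (ke * w0 * (x \in `[-1, 1])%:R +
      (ke * c * (x \in `[-1, - (3 / 4)])%:R + ke * c * (x \in `[3 / 4, 1])%:R) +
      (th * (x \in `[- H, -1[)%:R + th * (x \in `]1, H])%:R)) <=
    profile j.+3 A C H x + (3 * (ke * w0) * ((x \in `[-1, 1])%:R * x ^+ 2) +
      ke * b * (x \in `[-1, 1])%:R).
  rewrite /profile !in_itv/=.
  have [/andP[x1 x2]|x12] := boolP (-1 <= x <= 1).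
    have -> : (- H <= x <= H) = true by apply/andP; split; lra.
    have -> : (- H <= x < -1) = false by apply/negP => /andP[]; lra.
    have -> : (1 < x <= H) = false by apply/negP => /andP[]; lra.
    rewrite x1 x2 !mul1r !mulr1 mulr0 !addr0 andbT.
    have xx : x ^+ 2 <= 1 by nra.
    have := @gain_pointwise j t e b c x t01 e0 b0 hc xx.
    rewrite -/ke -/w0 -/A -/C.
    have -> : (9 / 16 <= x ^+ 2)%R%:R = (x <= - (3 / 4))%R%:R + (3 / 4 <= x)%R%:R :> R.
      have [h1|h1] := leP x (- (3 / 4)); have [h2|h2] := leP (3 / 4) x.
      - lra.
      - by rewrite addr0 (_ : 9 / 16 <= x ^+ 2)//; nra.
      - by rewrite add0r (_ : 9 / 16 <= x ^+ 2)//; nra.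
      - by rewrite addr0 (_ : _ <= _ = false)//; apply/negbTE; rewrite -ltNge; nra.
    nra.
  have -> : (-1 <= x <= - (3 / 4)) = false.
    by apply: contraNF x12 => /andP[? ?]; apply/andP; split; lra.
  have -> : (3 / 4 <= x <= 1) = false.
    by apply: contraNF x12 => /andP[? ?]; apply/andP; split; lra.
  rewrite !mul0r !mulr0 !add0r !addr0.
  have hx : - H <= x <= H -> th <= Num.sqrt (A - C * x ^+ 2) ^+ j.+3.
    by move=> /andP[h1 h2]; apply: hth; nra.
  have [/andP[h1 h2]|h] := boolP (- H <= x < -1).
    have hH : - H <= x <= H by apply/andP; split; lra.
    have -> : (1 < x <= H) = false by apply/negP => /andP[]; lra.
    by rewrite hH mulr0 addr0 mulr1 mul1r hx.
  rewrite mulr0 add0r; have [/andP[h1 h2]|h'] := boolP (1 < x <= H).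
    have hH : - H <= x <= H by apply/andP; split; lra.
    by rewrite hH mulr1 mul1r hx.
  by rewrite mulr0 mulr_ge0// exprn_ge0// sqrtr_ge0.
have p0 : 0 <= 3 * (ke * w0) by rewrite !mulr_ge0.
have q0 : 0 <= ke * b by rewrite mulr_ge0.
have q10 : 0 <= ke * w0 by rewrite mulr_ge0.
have kc0 : 0 <= ke * c by rewrite mulr_ge0.
move=> /(_ p0 q0 q10 kc0 th0 H1 pt).
rewrite -/(profile_integral _ _ _ _) -/(profile_integral _ _ _ _) => le_int.
rewrite -(@leeD2rE _ (2 / 3 * (3 * (ke * w0)) + 2 * (ke * b))%:E)//.
apply: le_trans le_int; rewrite -addeA -EFinD leeD2l// lee_fin.
rewrite le_eqVlt; apply/orP; left; apply/eqP; by field.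
Qed.

End cylinder_perturbation.

Section cylinder_counterexample.
Context {R : realType}.
Local Notation mu := (@lebesgue_measure R).

Let sqrt_expr_ge k (d u : R) : 0 <= d <= 1 -> 1 - d <= u ->
  1 - k%:R * d <= Num.sqrt u ^+ k.
Proof.
move=> /andP[d0 d1] du; apply: le_trans (bernoulli_ge k d _) _; first by rewrite d0.
rewrite lerXn2r ?nnegrE ?sqrtr_ge0//; first lra.
apply: le_trans (_ : Num.sqrt (1 - d) <= _); last by rewrite ler_wsqrtr.
have d1' : 0 <= 1 - d by lra.
by rewrite -[leLHS]ger0_norm// -sqrtr_sqr ler_wsqrtr//; nra.
Qed.

(** The squared radius is 1 + 2z with z = e (1 - b - 3x^2), so its root is at most 1 + z, and
    [bernoulli_le] bounds the power with an error controlled by |z| <= 4e. The mean of 3x^2 over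
    [-H, H] is H^2. *)
Let profile_volume_le (N : nat) (e b H : R) :
  0 <= e -> 0 <= b <= 1 -> 4 * e <= 1 -> N%:R * (4 * e) <= 2^-1 ->
  0 < H -> H ^+ 2 <= 4 / 3 ->
  (profile_integral N (1 + 2 * e * (1 - b)) (6 * e) H <=
   (2 * H * (1 + N%:R * e * (1 - b - H ^+ 2) + 2 * (N%:R * (4 * e)) ^+ 2))%:E)%E.
Proof.
move=> e0 /andP[b0 b1] e1 Ne H0 H43.
set A := 1 + _; set M := 2 * (N%:R * (4 * e)) ^+ 2.
have N0 : 0 <= N%:R :> R by [].
have Ne0 : 0 <= N%:R * e by rewrite mulr_ge0.
have M0 : 0 <= M by rewrite mulr_ge0// sqr_ge0.
have a0 : 0 <= 1 + N%:R * e * (1 - b) + M by rewrite !addr_ge0// mulr_ge0//; lra.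
have pt x : profile N A (6 * e) H x + 3 * (N%:R * e) * ((x \in `[- H, H])%:R * x ^+ 2) <=
    (1 + N%:R * e * (1 - b) + M) * (x \in `[- H, H])%:R.
  rewrite /profile in_itv/=; have [/andP[x1 x2]|_] := boolP (- H <= x <= H); last first.
    by rewrite !mul0r !mulr0 addr0.
  rewrite !mul1r mulr1; have xH : x ^+ 2 <= 4 / 3 by nra.
  have x0 := sqr_ge0 x.
  set z := e * (1 - b - 3 * x ^+ 2).
  have z1 : z <= 4 * e by rewrite /z; nra.
  have z2 : - (4 * e) <= z by rewrite /z; nra.
  have Nz1 : N%:R * z <= N%:R * (4 * e) by rewrite ler_wpM2l.
  have Nz2 : - (N%:R * (4 * e)) <= N%:R * z by rewrite -mulrN ler_wpM2l.
  have -> : A - 6 * e * x ^+ 2 = 1 + 2 * z by rewrite /A /z; ring.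
  have sz : Num.sqrt (1 + 2 * z) <= 1 + z.
    have z0 : 0 <= 1 + z by lra.
    by rewrite -[leRHS]ger0_norm// -sqrtr_sqr ler_wsqrtr//; nra.
  have := @bernoulli_le R N z; rewrite !ler_norml => bern.
  have {}bern : (1 + z) ^+ N <= 1 + N%:R * z + 2 * (N%:R * z) ^+ 2.
    by apply: bern; apply/andP; split; lra.
  have szN : Num.sqrt (1 + 2 * z) ^+ N <= (1 + z) ^+ N.
    by rewrite lerXn2r ?nnegrE ?sqrtr_ge0//; lra.
  have zM : 2 * (N%:R * z) ^+ 2 <= M by rewrite /M; nra.
  have Nz : N%:R * z = N%:R * e * (1 - b) - 3 * (N%:R * e) * x ^+ 2 by rewrite /z; ring.
  lra.
have m2 : measurable_fun setT (fun x : R => (x \in `[- H, H])%:R * x ^+ 2 : R).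
  by apply: measurable_funM; [exact: measurable_itv_natr|exact: measurable_funX].
have x20 (x : R) : 0 <= (x \in `[- H, H])%:R * x ^+ 2 by rewrite mulr_ge0// sqr_ge0.
have mi := measurable_itv_natr.
have Ne30 : 0 <= 3 * (N%:R * e) by rewrite mulr_ge0.
have nn x : 0 <= 3 * (N%:R * e) * ((x \in `[- H, H])%:R * x ^+ 2) by exact: mulr_ge0.
have : (\int[mu]_x (profile N A (6 * e) H x +
      3 * (N%:R * e) * ((x \in `[- H, H])%:R * x ^+ 2))%:E <=
    \int[mu]_x ((1 + N%:R * e * (1 - b) + M) * (x \in `[- H, H])%:R)%:E)%E.
  apply: ge0_le_integralT => x; last by rewrite lee_fin.
  by rewrite lee_fin addr_ge0// profile_ge0.
rewrite ge0_integralDT//; last 3 first.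
- exact: measurable_profile.
- exact: measurable_funM.
- exact: profile_ge0.
rewrite !ge0_integralZT//.
rewrite integral_sqr// integral_itv lebesgue_measure_itv/= lte_fin ifT; last lra.
rewrite -EFinB -!EFinM -/(profile_integral _ _ _ _) => le_int.
rewrite -(@leeD2rE _ (3 * (N%:R * e) * (2 / 3 * H ^+ 3))%:E)//.
apply: le_trans le_int _; rewrite -EFinD lee_fin.
by rewrite le_eqVlt; apply/orP; left; apply/eqP; field.
Qed.

(** With k = n - 2 and N = n - 1, the constants are chosen in the order t0, c, b, e: t0 separates
    the two regimes of slopes, c is the Chebyshev gain above t0, b is small against c, and e against
    b / N^2. *)
Lemma cylinder_counterexample j : exists A B H delta : R,
  [/\ 0 < A, 0 <= B, 0 < H, 0 < delta &
    (forall t, 0 <= t <= 1 ->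
      (profile_integral j.+3 1 t 1 + delta%:E <= profile_integral j.+3 A (B + t) H)%E) /\
    (profile_integral j.+4 A B H + delta%:E <= 2%:E)%E].
Proof.
have [k kE] : exists k : R, k = j.+3%:R by exists j.+3%:R.
have k3 : 3 <= k by rewrite kE ler_nat.
have [N NE] : exists N : R, N = k + 1 by exists (k + 1).
have N0 : N != 0 by rewrite NE gt_eqF//; lra.
have N2 : 16 <= N ^+ 2 by rewrite NE; nra.
have [t0 tN] : exists t0, 12 * N ^+ 2 * t0 = 1.
  by exists (12 * N ^+ 2)^-1; field.
have t00 : 0 < t0 by nra.
have [c c0 hc] := sqrt_gap j t0 t00.
have [b [b0 b1 bc]] : exists b, [/\ 0 < b, b <= 1 & b <= c / 8].
  exists (Num.min (c / 8) 1); split; last by rewrite ge_min lexx.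
    by rewrite lt_min ltr01 divr_gt0.
  by rewrite ge_min lexx orbT.
have [e eN] : exists e, (16 * N) ^+ 2 * e = b.
  by exists (b / (16 * N) ^+ 2); field.
have e0 : 0 < e.
  by clear - eN b0; have := sqr_ge0 (16 * N); nra.
have [H HE] : exists H, H = 1 + e * (k + 2^-1) * b by eexists.
have eb0 : 0 < e * b by rewrite mulr_gt0.
have Ne : 256 * (N * e) <= b / 4.
  have : 0 <= N * e * (N - 4) by rewrite !mulr_ge0 ?(ltW e0)// NE; clear - k3; lra.
  by clear - eN; lra.
have ke : k * e <= b / 1024.
  have -> : k * e = N * e - e by rewrite NE; ring.
  by clear - Ne e0; lra.
have e1 : e <= b / 4096 by clear - eN e0 N2; nra.
have ek0 : 0 <= e * (k + 2^-1) by rewrite mulr_ge0 ?(ltW e0)//; clear - k3; lra.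
have ek1 : e * (k + 2^-1) <= 1 / 8 by clear - ke e1 b1; lra.
have H1 : 1 <= H by rewrite HE lerDl mulr_ge0// ltW.
have H18 : H <= 9 / 8.
  have : e * (k + 2^-1) * b <= e * (k + 2^-1) by rewrite ler_piMr.
  by rewrite HE; clear - ek1; lra.
have H43 : H ^+ 2 <= 4 / 3 by clear - H1 H18; nra.
(* The first-order loss of volume is 2 (N e b - (H - 1)) = e b. Half of it is the margin; the rest
   absorbs the second-order terms. *)
exists (1 + 2 * e * (1 - b)), (6 * e), H, (e * b / 2); split.
- by clear - e0 b1; nra.
- by rewrite mulr_ge0// ltW.
- exact: lt_le_trans H1.
- exact: divr_gt0.
split=> [t /andP[t_ge0 t1]|].
  have t01 : 0 <= t <= 1 by rewrite t_ge0.
  (* For t >= t0 the Chebyshev gain alone suffices, since b <= c/8 gives c/2 - 2b >= 2b. *)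
  have [tt0|tt0] := leP t0 t.
    have htc : t0 <= t <= 1 by rewrite tt0.
    have := @profile_integral_gain R j t e b c 0 H t01 (ltW e0) (ltW b0) (ltW c0)
      (lexx _) H1 (hc t htc) _.
    move=> /(_ (fun _ _ => exprn_ge0 _ (sqrtr_ge0 _))); apply: le_trans.
    rewrite leeD2l// lee_fin mulr0 mul0r addr0 -kE.
    apply: le_trans (_ : k * e * (2 * b) <= _).
      have : 0 <= (k - 3) * (e * b) by rewrite mulr_ge0 ?subr_ge0 ?(ltW eb0).
      by clear - eb0; lra.
    rewrite ler_wpM2l ?mulr_ge0 ?(ltW e0)//; first by clear - k3; lra.
    by clear - bc; lra.
  (* With this th the end slabs gain 2 e b (k + 1/4), which exceeds the loss 2 k e b by exactly the
     margin e b / 2. *)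
  have [th thk] : exists th, th * (k + 2^-1) = k + 4^-1.
    by exists ((k + 4^-1) / (k + 2^-1)); field; clear - k3; lra.
  have th0 : 0 <= th by clear - thk k3; nra.
  have := @profile_integral_gain R j t e b 0 th H t01 (ltW e0) (ltW b0) (lexx _)
    th0 H1 _ _.
  move=> gain; apply: le_trans (gain _ _).
  - rewrite leeD2l// lee_fin -kE mul0r sub0r.
    have -> : 2 * th * (H - 1) = 2 * e * b * (th * (k + 2^-1)) by rewrite HE; ring.
    by rewrite thk; clear; lra.
  - rewrite mulr_ge0 ?subr_ge0// lerXn2r ?nnegrE ?sqrtr_ge0// ler_wsqrtr//.
    by clear - t_ge0; lra.
  (* On |x| <= H the squared radius is at least 1 - d, because x^2 <= 4/3. As th = 1 - 1/(4k + 2),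
     the bound th <= 1 - k d amounts to k d (4k + 2) <= 1. *)
  move=> x xH; have [d dE] : exists d, d = 8 * e + 4 / 3 * t0 by eexists.
  have kkN : k * (4 * k + 2) <= 4 * N ^+ 2 by clear - k3 NE; nra.
  have kd : k * d * (4 * k + 2) <= 1.
    have -> : k * d * (4 * k + 2) =
        k * (4 * k + 2) * (8 * e) + k * (4 * k + 2) * (4 / 3 * t0) by rewrite dE; ring.
    have le1 : k * (4 * k + 2) * (8 * e) <= 4 * N ^+ 2 * (8 * e).
      by rewrite ler_wpM2r// mulr_ge0// ltW.
    have le2 : k * (4 * k + 2) * (4 / 3 * t0) <= 4 * N ^+ 2 * (4 / 3 * t0).
      by rewrite ler_wpM2r// mulr_ge0// ltW.
    by clear - le1 le2 eN tN b1; lra.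
  have d0 : 0 <= d by clear - dE e0 t00; lra.
  have d01 : 0 <= d <= 1 by rewrite d0; clear - kd k3 d0; nra.
  apply: le_trans (sqrt_expr_ge _ _ _ d01 _); last first.
    have x0 := sqr_ge0 x.
    have tx : t * x ^+ 2 <= 4 / 3 * t0 by clear - x0 xH H43 tt0 t_ge0; nra.
    have ex : e * x ^+ 2 <= 4 / 3 * e by clear - x0 xH H43 e0; nra.
    have eb : e * b <= e by clear - e0 b1; nra.
    by rewrite dE; clear - tx ex eb; lra.
  have k0 : 0 < k + 2^-1 by clear - k3; lra.
  by rewrite -kE -(ler_pM2r k0) thk; clear - kd; lra.
have NE4 : j.+4%:R = N by rewrite NE kE natr1.
have Ne2 : j.+4%:R * (4 * e) <= 2^-1 by rewrite NE4; clear - Ne b1; lra.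
have b01 : 0 <= b <= 1 by rewrite ltW.
have e41 : 4 * e <= 1 by clear - e1 b1; lra.
have H0 : 0 < H by clear - H1; lra.
have := @profile_volume_le j.+4 e b H (ltW e0) b01 e41 Ne2 H0 H43.
rewrite NE4 => /(leeD2r (e * b / 2)%:E) /le_trans; apply.
rewrite -EFinD lee_fin.
have HH : N * e * (1 - b - H ^+ 2) <= - (N * e * b).
  have Neg0 : 0 <= N * e by rewrite NE mulr_ge0 ?(ltW e0)//; clear - k3; lra.
  by rewrite -[leRHS]mulrN ler_wpM2l//; clear - H1; nra.
(* The choice (16 N)^2 e = b makes the second-order error exactly e b / 8. *)
have M : 2 * (N * (4 * e)) ^+ 2 <= e * b / 8.
  by rewrite -eN le_eqVlt; apply/orP; left; apply/eqP; field.
have le2 : 2 * H * (1 + N * e * (1 - b - H ^+ 2) + 2 * (N * (4 * e)) ^+ 2) <=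
    2 * H * (1 - N * e * b + e * b / 8).
  rewrite ler_wpM2l//; first by rewrite mulr_ge0// ltW.
  by clear - HH M; lra.
(* With H = 1 + m and N e b = m + e b / 2, the volume bound becomes 2 (1 + m)(1 - m - 3 e b / 8), at
   most 2 - 3 e b / 4. *)
have [m mE] : exists m, m = e * (k + 2^-1) * b by eexists.
have m0 : 0 <= m by rewrite mE mulr_ge0// ltW.
have HmE : H = 1 + m by rewrite HE mE.
have NmE : N * e * b = m + e * b / 2 by rewrite NE mE; field.
move: le2; rewrite NmE HmE => /(lerD)/(_ (lexx (e * b / 2)))/le_trans; apply.
have meb : 0 <= m * (e * b) by rewrite mulr_ge0// ltW.
by clear - m0 eb0 meb; nra.
Qed.

End cylinder_counterexample.

(** * Reduction of all sections to slopes at most 1 *)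

Section sections_of_truncated_ellipsoids.
Context {R : realType}.
Local Notation mu := (@lebesgue_measure R).

Lemma section_integral_affine k (A B H rho r : R) : 0 < r ->
  section_integral k A B H rho =
  (r^-1%:E * \int[mu]_x (section_profile k A B H rho (x / r))%:E)%E.
Proof.
move=> r0; rewrite /section_integral (@ge0_integral_affine _ r^-1 0); last 3 first.
- by rewrite gt_eqF// invr_gt0.
- by apply/measurable_EFinP; exact: measurable_section_profile.
- by move=> s; rewrite lee_fin section_profile_ge0.
rewrite gtr0_norm ?invr_gt0//; congr (_ * _)%E.
by apply: eq_integral => x _; rewrite addr0 mulrC.
Qed.

(** Taking x_0 = rho s as variable exhibits t = (1 - rho^2) / rho^2 as the squared slope of the
    section. *)
Lemma section_integral_profile k (A B H rho : R) : 0 < rho ->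
  section_integral k A B H rho =
  (rho^-1%:E * profile_integral k A (B + (1 - rho ^+ 2) / rho ^+ 2) H)%E.
Proof.
move=> r0; rewrite (section_integral_affine _ _ _ _ _ _ r0); congr (_ * _)%E.
apply: eq_integral => x _; congr (_%:E); rewrite /section_profile /profile.
have -> : rho * (x / rho) = x by field; rewrite gt_eqF.
rewrite in_itv/= -ler_norml; congr (_ * Num.sqrt _ ^+ _).
by field; rewrite gt_eqF.
Qed.

Lemma section_integral1 k (A B H : R) :
  section_integral k A B H 1 = profile_integral k A B H.
Proof.
by rewrite section_integral_profile// expr1n subrr mul0r addr0 invr1 mul1e.
Qed.

Lemma profile_integral_cylinder k : profile_integral k 1 0 1 = 2%:E :> \bar R.
Proof.
transitivity (\int[mu]_x (-1 <= x <= 1)%R%:R%:E)%E.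
  apply: eq_integral => x _; rewrite /profile in_itv/= mul0r subr0 sqrtr1.
  by rewrite expr1n mulr1.
by rewrite integral_itvcc; [congr (_%:E)|]; lra.
Qed.

Lemma profile_integral_le2 k (t : R) : 0 <= t -> (profile_integral k 1 t 1 <= 2%:E)%E.
Proof.
move=> t0; apply: (@le_trans _ _ (\int[mu]_x (-1 <= x <= 1)%R%:R%:E)%E).
  apply: ge0_le_integralT => x; rewrite lee_fin ?profile_ge0//.
  rewrite /profile in_itv/=; apply: ler_piMr => //.
  rewrite exprn_ile1 ?sqrtr_ge0// -[leRHS]sqrtr1 ler_wsqrtr//.
  by rewrite gerBl mulr_ge0// sqr_ge0.
by rewrite integral_itvcc ?lee_fin; lra.
Qed.

(** The additive margin becomes a factor, independent of scale, because the profile integrals of the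
    cylinder are at most 2. *)
Lemma section_integral_gain k (A B H delta rho : R) : (0 < k)%N ->
  0 <= B -> 0 <= delta ->
  (forall t, 0 <= t <= 1 ->
     (profile_integral k 1 t 1 + delta%:E <= profile_integral k A (B + t) H)%E) ->
  0 <= rho <= 1 ->
  ((1 + delta / 2)%:E * section_integral k 1 0 1 rho <=
   section_integral k A B H rho)%E.
Proof.
move=> k0 B0 d0 gain /andP[r0 r1].
have {}gain t : 0 <= t <= 1 ->
    ((1 + delta / 2)%:E * profile_integral k 1 t 1 <= profile_integral k A (B + t) H)%E.
  move=> t01; apply: le_trans (gain t t01); have /andP[t0 _] := t01.
  have P0 : (0 <= profile_integral k 1 t 1)%E.
    by apply: integral_ge0 => x _; rewrite lee_fin profile_ge0.
  rewrite EFinD ge0_muleDl ?lee_fin// ?divr_ge0// mul1e leeD2l//.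
  apply: (@le_trans _ _ ((delta / 2)%:E * 2%:E)%E).
    by rewrite lee_wpmul2l ?lee_fin ?divr_ge0// profile_integral_le2.
  by rewrite -EFinM lee_fin divfK.
(* The condition rho^2 >= 1/2 says that the slope is at most 1. *)
have [rr|rr] := leP 2^-1 (rho ^+ 2).
  have {}r0 : 0 < rho by rewrite lt_neqAle r0 andbT eq_sym -sqrf_eq0 gt_eqF//; lra.
  rewrite !section_integral_profile// muleCA lee_wpmul2l//.
    by rewrite lee_fin invr_ge0 ltW.
  rewrite add0r; apply: gain; have rho2 : 0 < rho ^+ 2 by lra.
  rewrite divr_ge0 ?sqr_ge0//=; last by rewrite subr_ge0 expr_le1// ltW.
  by rewrite ler_pdivrMr//; lra.
(* For larger slopes, after rescaling by q, the section integrand of the cylinder is at most its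
   profile for t = 1, while that of the other body is at least its profile for t = 1. *)
pose q := Num.sqrt (1 - rho ^+ 2).
have q2 : q ^+ 2 = 1 - rho ^+ 2 by rewrite sqr_sqrtr//; lra.
have q0 : 0 < q by rewrite sqrtr_gt0; lra.
have rq : rho / q <= 1.
  rewrite ler_pdivrMr// mul1r -[leLHS]ger0_norm// -sqrtr_sqr ler_wsqrtr//; lra.
have rq0 : 0 <= rho / q by rewrite divr_ge0// ltW.
have rx (x : R) : rho * (x / q) = rho / q * x by field; rewrite gt_eqF.
have qx (x : R) : (1 - rho ^+ 2) * (x / q) ^+ 2 = x ^+ 2.
  by rewrite -q2; field; rewrite gt_eqF.
rewrite !(section_integral_affine _ _ _ _ _ _ q0) muleCA lee_wpmul2l//.
  by rewrite lee_fin invr_ge0 ltW.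
have g1 : (0 <= (1 : R)) && ((1 : R) <= 1) by rewrite ler01 /=.
apply: le_trans (le_trans (gain 1 g1) _).
  rewrite lee_wpmul2l ?lee_fin ?addr_ge0 ?divr_ge0//.
  apply: ge0_le_integralT => x; rewrite lee_fin ?section_profile_ge0//.
  rewrite /section_profile /profile mul0r subr0 qx mul1r in_itv/= -ler_norml.
  have [x1|x1] := leP `|x| 1.
    by rewrite mul1r ler_piMl ?exprn_ge0 ?sqrtr_ge0// lern1 leq_b1.
  rewrite ler0_sqrtr ?expr0n ?gtn_eqF// ?mulr0//.
  by rewrite subr_le0 -real_normK ?num_real//; nra.
apply: ge0_le_integralT => x; rewrite lee_fin ?profile_ge0//.
rewrite /section_profile /profile qx rx in_itv/= -ler_norml normrM (ger0_norm rq0).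
have [xH|xH] := leP `|x| H; last first.
  by rewrite mul0r mulr_ge0// exprn_ge0// sqrtr_ge0.
rewrite (_ : _ <= H)%R; last first.
  by apply: le_trans xH; rewrite ler_piMl.
rewrite !mul1r lerXn2r ?nnegrE ?sqrtr_ge0// ler_wsqrtr//.
have : (rho / q * x) ^+ 2 <= x ^+ 2.
  by rewrite exprMn ler_piMl ?sqr_ge0// expr_le1.
nra.
Qed.

End sections_of_truncated_ellipsoids.

(** * Bodies in the ball model *)

Section real_continuity.
Context {R : realType} {T : topologicalType}.
Implicit Types f g : T -> R.

Lemma real_continuousM f g : continuous f -> continuous g ->
  continuous (fun x => f x * g x).
Proof. by move=> cf cg x; apply: cvgM; [exact: cf|exact: cg]. Qed.

Lemma real_continuousD f g : continuous f -> continuous g ->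
  continuous (fun x => f x + g x).
Proof. move=> cf cg x; exact: (@cvgD _ R^o _ _ _ f g _ _ (cf x) (cg x)). Qed.

Lemma real_continuousB f g : continuous f -> continuous g ->
  continuous (fun x => f x - g x).
Proof. move=> cf cg x; exact: (@cvgB _ R^o _ _ _ f g _ _ (cf x) (cg x)). Qed.

Lemma real_continuous_norm f : continuous f -> continuous (fun x => `|f x|).
Proof. by move=> cf x; apply: cvg_norm; exact: cf. Qed.

Lemma closed_ge0 f : continuous f -> closed [set x | 0 <= f x].
Proof. by move=> /continuous_closedP/(_ [set y | 0 <= y]); apply; exact: closed_ge. Qed.

Lemma near_gt0 f x : continuous f -> 0 < f x -> \forall y \near x, 0 < f y.
Proof. by move=> cf fx0; exact: (cvgr_gt (f x) (cf x)). Qed.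

End real_continuity.

Section model_bodies.
Context {R : realType}.

Lemma sqnormN n (x : 'rV[R]_n) : sqnorm (- x) = sqnorm x.
Proof. by apply: eq_bigr => i _; rewrite mxE sqrrN. Qed.

Lemma sqnormZ n (c : R) (x : 'rV[R]_n) : sqnorm (c *: x) = c ^+ 2 * sqnorm x.
Proof. by rewrite /sqnorm mulr_sumr; apply: eq_bigr => i _; rewrite mxE exprMn. Qed.

Lemma sqr_coord_le_sqnorm n (x : 'rV[R]_n) i : x ord0 i ^+ 2 <= sqnorm x.
Proof. by rewrite /sqnorm (bigD1 i)//= lerDl sumr_ge0// => l _; exact: sqr_ge0. Qed.

Lemma continuous_sqnorm n : continuous (@sqnorm R n).
Proof.
apply: continuous_big; first exact: add_continuous.
move=> i _ x.
apply: (@continuous_comp _ _ _ (fun y : 'rV[R]_n => y ord0 i) (fun u : R => u ^+ 2)).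
  exact: coord_continuous.
exact: exprn_continuous.
Qed.

Lemma trunc_ellipsoidN A B H n (x : 'rV[R]_n.+1) :
  trunc_ellipsoid A B H x -> trunc_ellipsoid A B H (- x).
Proof. by rewrite /trunc_ellipsoid /= sqnormN mxE normrN sqrrN. Qed.

Lemma trunc_ellipsoidZ A B H n (c d : R) (x : 'rV[R]_n.+1) :
  0 <= A -> 0 <= c <= d -> trunc_ellipsoid A B H x ->
  trunc_ellipsoid (d ^+ 2 * A) B (d * H) (c *: x).
Proof.
move=> A0 /andP[c0 cd] /andP[h1 h2]; apply/andP; split.
  rewrite mxE normrM (ger0_norm c0); apply: ler_pM => //.
rewrite sqnormZ mxE; apply: le_trans (_ : c ^+ 2 * A <= _).
  rewrite exprMn mulrCA -mulrDr ler_wpM2l ?sqr_ge0//.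
by rewrite ler_wpM2r// lerXn2r ?nnegrE ?(le_trans c0).
Qed.

Lemma trunc_ellipsoid_sqnorm A B H n (x : 'rV[R]_n.+1) : 0 <= B ->
  trunc_ellipsoid A B H x -> sqnorm x <= A + H ^+ 2.
Proof.
move=> B0 /andP[h1 h2].
have x0 : x ord0 ord0 ^+ 2 <= H ^+ 2.
  by rewrite -real_normK ?num_real// lerXn2r// nnegrE (le_trans _ h1).
have := sqr_ge0 (x ord0 ord0); nra.
Qed.

Let sqr_convex (t a b : R) : 0 <= t <= 1 ->
  ((1 - t) * a + t * b) ^+ 2 <= (1 - t) * a ^+ 2 + t * b ^+ 2.
Proof.
move=> /andP[t0 t1]; rewrite -subr_ge0.
rewrite (_ : _ - _ = t * (1 - t) * (a - b) ^+ 2); last by ring.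
by rewrite mulr_ge0 ?sqr_ge0// mulr_ge0// subr_ge0.
Qed.

Lemma trunc_ellipsoid_convex A B H n (x y : 'rV[R]_n.+1) (t : R) :
  0 <= B -> 0 <= t <= 1 ->
  trunc_ellipsoid A B H x -> trunc_ellipsoid A B H y ->
  trunc_ellipsoid A B H ((1 - t) *: x + t *: y).
Proof.
move=> B0 t01 /andP[x1 x2] /andP[y1 y2]; have /andP[t0 t1] := t01.
have t10 : 0 <= 1 - t by rewrite subr_ge0.
apply/andP; split.
  rewrite !mxE (le_trans (ler_normD _ _))// !normrM (ger0_norm t0) (ger0_norm t10).
  have -> : H = (1 - t) * H + t * H by ring.
  by rewrite lerD// ler_wpM2l.
(* Written as |x'|^2 + B x_0^2, the quadratic form has nonnegative coefficients, so it is convex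
   coordinate by coordinate. *)
have split_head (z : 'rV[R]_n.+1) : sqnorm z + (B - 1) * z ord0 ord0 ^+ 2 =
    \sum_(i < n) z ord0 (lift ord0 i) ^+ 2 + B * z ord0 ord0 ^+ 2.
  by rewrite /sqnorm big_ord_recl; ring.
rewrite !split_head in x2 y2 *.
apply: le_trans (_ : (1 - t) * A + t * A <= _); last by rewrite -mulrDl subrK mul1r.
apply: le_trans (lerD (ler_wpM2l t10 x2) (ler_wpM2l t0 y2)).
rewrite !mulrDr addrACA lerD//.
  rewrite !mulr_sumr -big_split ler_sum// => i _; rewrite !mxE; exact: sqr_convex.
rewrite ![_ * (B * _)]mulrCA -mulrDr ler_wpM2l// !mxE; exact: sqr_convex.
Qed.

(* The preimage under the projective model map, in which geodesics are
   straight, of a truncated ellipsoid. *)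
Definition proj_body (delta A B H : R) {n} : set 'rV[R]_n.+1 :=
  [set x | sqnorm x < 1 /\ trunc_ellipsoid A B H (proj_model delta x)].

Section properties.
Context (delta A B H : R) (n : nat).
Hypotheses (d1 : `|delta| <= 1) (A0 : 0 < A) (B0 : 0 <= B) (H0 : 0 < H).
Hypothesis small : A + H ^+ 2 <= 4^-1.
Local Notation K := (@proj_body delta A B H n).

Let conformal_factor (x : 'rV[R]_n.+1) : `|delta * sqnorm x| <= sqnorm x.
Proof. by rewrite normrM (ger0_norm (sqnorm_ge0 _ _)) ler_piMl// sqnorm_ge0. Qed.

(** On the ball, [proj_model] multiplies by 2/(1 - delta |x|^2) >= 1. *)
Lemma proj_body_sqnorm (x : 'rV[R]_n.+1) : K x -> sqnorm x <= A + H ^+ 2.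
Proof.
move=> [x1 /(trunc_ellipsoid_sqnorm _ _ _ _ _ B0)]; apply: le_trans.
have := conformal_factor x; rewrite ler_norml => /andP[h1 h2].
have f0 : 0 < 1 - delta * sqnorm x by lra.
rewrite /proj_model sqnormZ ler_peMl ?sqnorm_ge0//.
have : 1 <= 2 / (1 - delta * sqnorm x) by rewrite ler_pdivlMr// mul1r; lra.
nra.
Qed.

Lemma proj_body_convex : geod_convex delta K.
Proof.
move=> a b [_ Ka] [_ Kb] z [z1 [t [t01 projz]]]; split=> //.
by rewrite projz; exact: trunc_ellipsoid_convex.
Qed.

Lemma proj_body_symmetric : origin_symmetric K.
Proof.
have KN x : K x -> K (- x).
  move=> [x1 Kx]; split; first by rewrite sqnormN.
  by rewrite /proj_model sqnormN scalerN; exact: trunc_ellipsoidN.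
apply/seteqP; split => [_ [x Kx <-]|x Kx]; first exact: KN.
by exists (- x); rewrite ?opprK//; exact: KN.
Qed.

(** With [g2], the conditions defining the ellipsoid cleared of the denominator 1 - delta |x|^2;
    both functions are continuous on the whole space. *)
Let g1 (x : 'rV[R]_n.+1) := H * (1 - delta * sqnorm x) - 2 * `|x ord0 ord0|.
Let g2 (x : 'rV[R]_n.+1) := A * ((1 - delta * sqnorm x) * (1 - delta * sqnorm x)) -
  4 * (sqnorm x + (B - 1) * (x ord0 ord0 * x ord0 ord0)).

Let coord0_continuous : continuous (fun x : 'rV[R]_n.+1 => x ord0 ord0 : R).
Proof. exact: coord_continuous. Qed.

Let g1_continuous : continuous g1.
Proof.
apply: real_continuousB; apply: real_continuousM; try exact: cst_continuous.
  apply: real_continuousB; first exact: cst_continuous.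
  by apply: real_continuousM; [exact: cst_continuous|exact: continuous_sqnorm].
by apply: real_continuous_norm; exact: coord0_continuous.
Qed.

Let g2_continuous : continuous g2.
Proof.
have cf : continuous (fun x : 'rV[R]_n.+1 => 1 - delta * sqnorm x).
  apply: real_continuousB; first exact: cst_continuous.
  by apply: real_continuousM; [exact: cst_continuous|exact: continuous_sqnorm].
apply: real_continuousB; apply: real_continuousM; try exact: cst_continuous.
  exact: real_continuousM.
apply: real_continuousD; first exact: continuous_sqnorm.
apply: real_continuousM; first exact: cst_continuous.
by apply: real_continuousM; exact: coord0_continuous.
Qed.

Let proj_bodyE (x : 'rV[R]_n.+1) : sqnorm x < 1 ->
  trunc_ellipsoid A B H (proj_model delta x) <-> 0 <= g1 x /\ 0 <= g2 x.
Proof.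
move=> x1; have := conformal_factor x; rewrite ler_norml => /andP[h1 h2].
have f0 : 0 < 1 - delta * sqnorm x by lra.
rewrite /trunc_ellipsoid /= /proj_model sqnormZ mxE normrM gtr0_norm ?divr_gt0//.
have -> : (2 / (1 - delta * sqnorm x) * `|x ord0 ord0| <= H) = (0 <= g1 x).
  by rewrite mulrAC ler_pdivrMr// subr_ge0.
have -> : ((2 / (1 - delta * sqnorm x)) ^+ 2 * sqnorm x +
    (B - 1) * (2 / (1 - delta * sqnorm x) * x ord0 ord0) ^+ 2 <= A) = (0 <= g2 x).
  have -> : (2 / (1 - delta * sqnorm x)) ^+ 2 * sqnorm x +
      (B - 1) * (2 / (1 - delta * sqnorm x) * x ord0 ord0) ^+ 2 =
      (4 * (sqnorm x + (B - 1) * (x ord0 ord0 * x ord0 ord0))) /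
      ((1 - delta * sqnorm x) * (1 - delta * sqnorm x)).
    by field; rewrite gt_eqF.
  by rewrite ler_pdivrMr ?mulr_gt0// subr_ge0.
by split=> [/andP//|[-> ->]].
Qed.

Lemma proj_body_model : model_body K.
Proof.
split; first by move=> x [].
split; last first.
  exists 0; rewrite /interior /=.
  have s0 : @sqnorm R n.+1 0 = 0 by rewrite /sqnorm big1// => i _; rewrite mxE expr0n.
  have h1 : 0 < g1 0 by rewrite /g1 s0 mxE normr0 !mulr0 !subr0 mulr1.
  have h2 : 0 < g2 0 by rewrite /g2 s0 mxE !mulr0 addr0 mulr0 !subr0 !mulr1.
  have h3 : 0 < 1 - @sqnorm R n.+1 0 by rewrite s0 subr0.
  have c3 : continuous (fun x : 'rV[R]_n.+1 => 1 - sqnorm x).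
    by apply: real_continuousB; [exact: cst_continuous|exact: continuous_sqnorm].
  near=> x; have x1 : sqnorm x < 1.
    by rewrite -subr_gt0; near: x; exact: (near_gt0 _ _ c3 h3).
  split=> //; apply/(proj_bodyE _ x1); split; apply: ltW; near: x.
    exact: (near_gt0 _ _ g1_continuous h1).
  exact: (near_gt0 _ _ g2_continuous h2).
apply: bounded_closed_compact.
  exists 1; split=> // M M1 x Kx; rewrite /= [leLHS]mx_normrE.
  apply: bigmax_le => [|[i l] _ /=]; first by rewrite ltW// (lt_trans ltr01).
  rewrite ord1; have := sqr_coord_le_sqnorm _ x l; have := proj_body_sqnorm _ Kx.
  rewrite -(real_normK (num_real (x ord0 l))) -[x 0 l]/(x ord0 l).
  move=> xA xl; apply: le_trans (ltW M1).
  rewrite -(@expr_le1 _ 2)//; apply: le_trans xl (le_trans xA (le_trans small _)).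
  by rewrite invf_le1 ?ler1n.
(* The norm bound lets the closed condition |x|^2 <= 1/4 replace the open one |x|^2 < 1, which makes
   the body closed. *)
have -> : K = [set x | 0 <= 4^-1 - sqnorm x] `&` [set x | 0 <= g1 x] `&` [set x | 0 <= g2 x].
  apply/seteqP; split => [x Kx|x [[/= x1 h1] h2]].
    have x4 := proj_body_sqnorm _ Kx; have [x1 Ex] := Kx.
    have [? ?] := (proj_bodyE _ x1).1 Ex.
    by split=> //; split=> //=; rewrite subr_ge0 (le_trans x4).
  have x1' : sqnorm x < 1 by lra.
  by split=> //; apply/(proj_bodyE _ x1').
apply: closedI; first apply: closedI; apply: closed_ge0 => //.
by apply: real_continuousB; [exact: cst_continuous|exact: continuous_sqnorm].
Unshelve. all: by end_near. Qed.

End properties.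
End model_bodies.

(** * Small bodies between two dilated ellipsoids *)

Section small_bodies.
Context {R : realType}.
Variables (delta A B H w : R) (n : nat).
Hypotheses (d1 : `|delta| <= 1) (A0 : 0 < A) (B0 : 0 <= B).
Hypotheses (small : A + H ^+ 2 <= w) (w4 : w <= 4^-1).
Local Notation K := (@proj_body R delta A B H n).
Local Notation E c := (@trunc_ellipsoid R n (c ^+ 2 * A) B (c * H)).

Let w0 : 0 < w.
Proof. by rewrite (lt_le_trans _ small)// ltr_wpDr// sqr_ge0. Qed.

Let factor_bounds (x : 'rV[R]_n.+1) : sqnorm x <= w ->
  [/\ 0 < 1 - w, 1 - w <= 1 - delta * sqnorm x <= 1 + w &
      1 - w <= 1 + delta * sqnorm x <= 1 + w].
Proof.
move=> xw; have : `|delta * sqnorm x| <= w.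
  apply: le_trans xw; rewrite normrM (ger0_norm (sqnorm_ge0 _ _)).
  by rewrite ler_piMl// sqnorm_ge0.
rewrite ler_norml => /andP[h1 h2].
split.
- by rewrite subr_gt0 (le_lt_trans w4)// invf_lt1 ?ltr1n.
- by rewrite lerB// lerD2l lerNl h1.
- by rewrite !lerD2l h1.
Qed.

(** A point is (1 - delta |x|^2)/2 times its image under [proj_model], and on the body this factor
    is at most (1 + w)/2. *)
Lemma proj_body_sub_ellipsoid : K `<=` E ((1 + w) / 2).
Proof.
move=> x Kx; have xw := le_trans (proj_body_sqnorm _ _ _ _ _ d1 B0 _ Kx) small.
have [w1 /andP[h1 h2] _] := factor_bounds _ xw.
have [_ Ex] := Kx.
have -> : x = ((1 - delta * sqnorm x) / 2) *: proj_model delta x.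
  rewrite /proj_model scalerA mulrA divfK// divff ?scale1r//.
  by rewrite gt_eqF//; lra.
apply: trunc_ellipsoidZ Ex; first exact: ltW.
by apply/andP; split; lra.
Qed.

Lemma ellipsoid_sub_proj_body : E ((1 - w) / 2) `<=` K.
Proof.
move=> x Ex; have c1 : ((1 - w) / 2) ^+ 2 <= 1 by have := w0; have := w4; nra.
have xw : sqnorm x <= w.
  apply: le_trans (trunc_ellipsoid_sqnorm _ _ _ _ _ B0 Ex) (le_trans _ small).
  rewrite [(_ * H) ^+ 2]exprMn -mulrDr ler_piMl//.
  by rewrite addr_ge0 ?sqr_ge0// ltW.
have [w1 /andP[h1 h2] _] := factor_bounds _ xw.
split; first by move: w4; lra.
have f0 : 0 < 1 - delta * sqnorm x by lra.
have := trunc_ellipsoidZ _ _ _ _ (2 / (1 - delta * sqnorm x)) (2 / (1 - w)) _ _ _ Ex.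
have w1n : 1 - w != 0 by rewrite gt_eqF.
have -> : (2 / (1 - w)) ^+ 2 * (((1 - w) / 2) ^+ 2 * A) = A by field.
have -> : 2 / (1 - w) * ((1 - w) / 2 * H) = H by field.
apply.
  by rewrite mulr_ge0 ?sqr_ge0// ltW.
rewrite divr_ge0 ?(ltW f0)//= ler_pM2l// lef_pV2//.
Qed.

(** On the body the density is at most (1 - w)^-N. The map [phi] will be the identity for volumes
    and the parametrization of the hyperplane for sections. *)
Lemma iint_proj_body_le m N (phi : 'rV[R]_m -> 'rV[R]_n.+1) :
  (iint (fun y => (\1_K (phi y) * (1 + delta * sqnorm (phi y)) ^- N)%:E) <=
   ((1 - w) ^- N)%:E * iint (fun y => (\1_(E ((1 + w) / 2)) (phi y))%:E))%E.
Proof.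
have w1 : 0 < 1 - w by move: w4; lra.
rewrite -iintZl//; last by rewrite invr_gt0 exprn_gt0.
apply: le_iint => y; rewrite -?EFinM lee_fin indicE.
  have [/[!inE] Ky|] := boolP (phi y \in K); last by rewrite mul0r.
  have xw := le_trans (proj_body_sqnorm _ _ _ _ _ d1 B0 _ Ky) small.
  have [_ _ /andP[h1 h2]] := factor_bounds _ xw.
  by rewrite mul1r invr_ge0 exprn_ge0//; lra.
rewrite indicE; have [/[!inE] Ky|] := boolP (phi y \in K); last first.
  by rewrite mul0r mulr_ge0// invr_ge0 exprn_ge0// ltW.
have xw := le_trans (proj_body_sqnorm _ _ _ _ _ d1 B0 _ Ky) small.
have [_ _ /andP[h1 h2]] := factor_bounds _ xw.
rewrite mem_set; last exact: proj_body_sub_ellipsoid.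
rewrite mul1r mulr1 lef_pV2 ?posrE ?exprn_gt0//; last by lra.
by rewrite lerXn2r ?nnegrE//; lra.
Qed.

Lemma iint_proj_body_ge m N (phi : 'rV[R]_m -> 'rV[R]_n.+1) :
  (((1 + w) ^- N)%:E * iint (fun y => (\1_(E ((1 - w) / 2)) (phi y))%:E) <=
   iint (fun y => (\1_K (phi y) * (1 + delta * sqnorm (phi y)) ^- N)%:E))%E.
Proof.
have w1 : 0 < 1 - w by move: w4; lra.
have w2 : 0 < 1 + w by move: w0; lra.
rewrite -iintZl//; last by rewrite invr_gt0 exprn_gt0.
apply: le_iint => y; rewrite -?EFinM lee_fin.
  by rewrite mulr_ge0// invr_ge0 exprn_ge0// ltW.
rewrite !indicE; have [/[!inE] Ey|] := boolP (phi y \in E _); last first.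
  rewrite mulr0; have [/[!inE] Ky|] := boolP (phi y \in K); last by rewrite mul0r.
  have xw := le_trans (proj_body_sqnorm _ _ _ _ _ d1 B0 _ Ky) small.
  have [_ _ /andP[h1 h2]] := factor_bounds _ xw.
  by rewrite mul1r invr_ge0 exprn_ge0//; lra.
have Ky := ellipsoid_sub_proj_body _ Ey.
have xw := le_trans (proj_body_sqnorm _ _ _ _ _ d1 B0 _ Ky) small.
have [_ _ /andP[h1 h2]] := factor_bounds _ xw.
rewrite mem_set// mul1r mulr1 lef_pV2 ?posrE ?exprn_gt0//; last by lra.
by rewrite lerXn2r ?nnegrE//; lra.
Qed.

End small_bodies.

(** * Choice of the scale and transfer to the ball models *)

Lemma small_ratio (R : realType) (M : nat) (eta : R) : 0 < eta ->
  exists w : R, [/\ 0 < w, w <= 4^-1 & forall m lam, (m <= M)%N -> 0 < lam ->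
    (1 - w) ^- m * ((1 + w) / 2 * lam) ^+ m <=
    (1 + eta) * ((1 + w) ^- m * ((1 - w) / 2 * lam) ^+ m)].
Proof.
move=> eta0; have [h [h0 h1 heta]] : exists h, [/\ 0 < h, h <= 1 & h <= eta].
  by exists (Num.min eta 1); rewrite lt_min eta0 ltr01 !ge_min !lexx orbT.
have M0 : 0 <= M%:R :> R by [].
have [w wM] : exists w, 8 * (M%:R + 1) * w = h.
  by exists (h / (8 * (M%:R + 1))); field; rewrite gt_eqF//; lra.
have w0 : 0 < w by nra.
have w4 : w <= 4^-1 by nra.
exists w; split=> // m lam mM lam0; have m0 : 0 <= m%:R :> R by [].
have mw : m%:R * w <= h / 8.
  have : m%:R <= M%:R :> R by rewrite ler_nat.
  nra.
have w01 : 0 <= w <= 1 by apply/andP; split; lra.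
have lo : 1 - h / 8 <= (1 - w) ^+ m by apply: le_trans (bernoulli_ge m w w01); lra.
have p0 : 0 < (1 + w) ^+ m by rewrite exprn_gt0//; lra.
have q0 : 0 < (1 - w) ^+ m by rewrite exprn_gt0//; lra.
have pq1 : (1 + w) ^+ m * (1 - w) ^+ m <= 1.
  by rewrite -exprMn exprn_ile1//; nra.
have s0 : 0 < (lam / 2) ^+ m by rewrite exprn_gt0// divr_gt0.
have -> : (1 + w) / 2 * lam = (1 + w) * (lam / 2) by ring.
have -> : (1 - w) / 2 * lam = (1 - w) * (lam / 2) by ring.
rewrite [((1 + w) * _) ^+ m]exprMn [((1 - w) * _) ^+ m]exprMn.
move: ((1 + w) ^+ m) ((1 - w) ^+ m) ((lam / 2) ^+ m) lo p0 q0 pq1 s0.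
move=> p q s lo p0 q0 pq1 s0.
(* The two sides differ by the factor (p/q)^2 against 1 + eta. As p q <= 1, it suffices that (1 +
   eta) q^4 >= 1; here q^4 >= 1 - h/2 with h <= 1 and h <= eta. *)
have q4 : 1 <= (1 + eta) * (q ^+ 2 * q ^+ 2).
  have h2 : (1 - h / 8) ^+ 2 <= q ^+ 2 by rewrite lerXn2r// ?nnegrE; lra.
  have h4 : 1 - h / 4 <= q ^+ 2 by apply: le_trans h2; nra.
  have h8 : 1 - h / 2 <= q ^+ 2 * q ^+ 2 by clear - h4 h0 h1; nra.
  by clear - h8 h0 h1 heta; nra.
have pq : p ^+ 2 <= (1 + eta) * q ^+ 2.
  have q20 : 0 < q ^+ 2 by rewrite exprn_gt0.
  have pq2 : p ^+ 2 * q ^+ 2 <= 1 by rewrite -exprMn exprn_ile1// mulr_ge0// ltW.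
  rewrite -(ler_pM2r q20); apply: le_trans pq2 _.
  by rewrite -mulrA.
have -> : q^-1 * (p * s) = p ^+ 2 * (s / (p * q)) by field; rewrite !gt_eqF.
have -> : (1 + eta) * (p^-1 * (q * s)) = (1 + eta) * q ^+ 2 * (s / (p * q)).
  by field; rewrite !gt_eqF.
by rewrite ler_wpM2r// divr_ge0 ?mulr_ge0// ltW.
Qed.

Lemma small_scale (R : realType) (A H w : R) : 0 <= A -> 0 < w ->
  exists2 lam : R, 0 < lam &
    lam ^+ 2 * 1 + (lam * 1) ^+ 2 <= w /\ lam ^+ 2 * A + (lam * H) ^+ 2 <= w.
Proof.
move=> A0 w0; have H2 := sqr_ge0 H.
have [D DE] : exists D, D = 2 + A + H ^+ 2 by eexists.
have D0 : 0 < D by rewrite DE; lra.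
have lamD : Num.sqrt (w / D) ^+ 2 * D = w.
  by rewrite sqr_sqrtr ?divr_ge0 ?(ltW w0) ?(ltW D0)// divfK// gt_eqF.
exists (Num.sqrt (w / D)); first by rewrite sqrtr_gt0 divr_gt0.
move: (Num.sqrt (w / D)) lamD => lam lamD; have lam2 := sqr_ge0 lam.
have lA : 0 <= lam ^+ 2 * A by rewrite mulr_ge0.
have lH : 0 <= lam ^+ 2 * H ^+ 2 by rewrite mulr_ge0.
by rewrite !exprMn expr1n -lamD DE; split; lra.
Qed.

(** Combines the two inclusions, the bounds on the density and the homogeneity of section integrals;
    it serves both volumes and sections. *)
Lemma proj_body_volume_bounds (R : realType) (delta A B H w lam kappa rho : R) k n
    (phi : 'rV[R]_k.+1 -> 'rV[R]_n.+1) :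
  `|delta| <= 1 -> 0 < A -> 0 <= B -> 0 < lam ->
  lam ^+ 2 * A + (lam * H) ^+ 2 <= w -> 0 < w -> w <= 4^-1 -> 0 < kappa ->
  (forall A' B' H', iint (fun y => (\1_(trunc_ellipsoid A' B' H') (phi y))%:E) =
    (kappa%:E * section_integral k A' B' H' rho)%E) ->
  let V := iint (fun y => (\1_(proj_body delta (lam ^+ 2 * A) B (lam * H)) (phi y) *
    (1 + delta * sqnorm (phi y)) ^- k.+1)%:E) in
  ((kappa * ((1 + w) ^- k.+1 * ((1 - w) / 2 * lam) ^+ k.+1))%:E *
     section_integral k A B H rho <= V)%E /\
  (V <= (kappa * ((1 - w) ^- k.+1 * ((1 + w) / 2 * lam) ^+ k.+1))%:E *
     section_integral k A B H rho)%E.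
Proof.
move=> d1 A0 B0 lam0 small w0 w4 kappa0 phiE V.
have lA0 : 0 < lam ^+ 2 * A by rewrite mulr_gt0// exprn_gt0.
have scale (c : R) : 0 < c -> iint (fun y =>
    (\1_(trunc_ellipsoid (c ^+ 2 * (lam ^+ 2 * A)) B (c * (lam * H))) (phi y))%:E) =
    ((kappa * (c * lam) ^+ k.+1)%:E * section_integral k A B H rho)%E.
  move=> c0; rewrite phiE.
  have -> : c ^+ 2 * (lam ^+ 2 * A) = (c * lam) ^+ 2 * A by ring.
  have -> : c * (lam * H) = c * lam * H by ring.
  rewrite section_integral_scale ?mulr_gt0//.
  by rewrite muleA -EFinM.
have w1 : 0 < (1 - w) / 2 by rewrite divr_gt0//; lra.
have w2 : 0 < (1 + w) / 2 by rewrite divr_gt0//; lra.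
split.
  apply: le_trans (iint_proj_body_ge _ _ _ _ _ _ d1 lA0 B0 small w4 _ _ phi).
  by rewrite scale// muleA -EFinM (mulrCA kappa).
apply: le_trans (iint_proj_body_le _ _ _ _ _ _ d1 lA0 B0 small w4 _ _ phi) _.
by rewrite scale// muleA -EFinM (mulrCA kappa).
Qed.

(* delta = 1 : the sphere S^n (open hemisphere); delta = -1 : H^n *)
Theorem theorem3 (R : realType) (n : nat) (delta : R) :
  (5 <= n)%N -> (delta = 1 \/ delta = -1) ->
  exists K L : set 'rV[R]_n,
    [/\ model_body K /\ geod_convex delta K /\ origin_symmetric K,
        model_body L /\ geod_convex delta L /\ origin_symmetric L,
        (forall (xi : 'rV[R]_n) (P : 'M[R]_(n.-1, n)),
            sqnorm xi = 1 ->
            P *m P^T = 1%:M -> P *m xi^T = 0 ->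
            (secvol delta P K <= secvol delta P L)%E)
      & (vol delta L < vol delta K)%E].
Proof.
case: n => [|[|[|[|[|j]]]]]// _ d11.
have d1 : `|delta| <= 1 by case: d11 => ->; rewrite ?normrN normr1.
have [A [B [H [eta [A0 B0 H0 eta0 [gain volL]]]]]] := @cylinder_counterexample R j.
have [kappa kappa0 volE] := @iint_trunc_ellipsoid R j.+3.
have [kappa' kappa'0 secE] := @iint_section_trunc_ellipsoid R j.+3 isT.
have eta20 : 0 < eta / 2 by rewrite divr_gt0.
(* The distortion allowed, 1 + eta/2, is the factor that [section_integral_gain] provides. *)
have [w [w0 w4 ratio]] := @small_ratio R j.+1.+4 (eta / 2) eta20.
have [lam lam0 [smallK smallL]] := @small_scale R A H w (ltW A0) w0.
(* The body K comes from the cylinder and L from its perturbation, both shrunk by the same [lam]. *)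
pose K := @proj_body R delta (lam ^+ 2 * 1) 0 (lam * 1) j.+4.
pose L := @proj_body R delta (lam ^+ 2 * A) B (lam * H) j.+4.
have l20 : 0 < lam ^+ 2 by rewrite exprn_gt0.
have lA0 : 0 < lam ^+ 2 * A by rewrite mulr_gt0.
have lH0 : 0 < lam * H by rewrite mulr_gt0.
have l10 : 0 < lam ^+ 2 * 1 by rewrite mulr1.
have l1 : 0 < lam * 1 by rewrite mulr1.
have b0 m : 0 < (1 + w) ^- m * ((1 - w) / 2 * lam) ^+ m.
  by rewrite mulr_gt0 ?invr_gt0 ?exprn_gt0//; [lra|rewrite mulr_gt0// divr_gt0//; lra].
exists K, L; split.
- split; first exact: proj_body_model _ _ _ _ _ d1 l10 (lexx 0) l1 (le_trans smallK w4).
  by split; [exact: proj_body_convex|exact: proj_body_symmetric].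
- split; first exact: proj_body_model _ _ _ _ _ d1 lA0 B0 lH0 (le_trans smallL w4).
  by split; [exact: proj_body_convex|exact: proj_body_symmetric].
- move=> xi P _ PP _; have [rho rho01 rhoE] := secE P PP.
  have [_ leK] := proj_body_volume_bounds R delta 1 0 1 w lam kappa' rho j.+3 j.+4
    (fun y => y *m P) d1 ltr01 (lexx 0) lam0 smallK w0 w4 kappa'0 rhoE.
  have [geL _] := proj_body_volume_bounds R delta A B H w lam kappa' rho j.+3 j.+4
    (fun y => y *m P) d1 A0 B0 lam0 smallL w0 w4 kappa'0 rhoE.
  rewrite /secvol; apply: lee_wpmul2l; first by rewrite lee_fin exprn_ge0.
  apply: le_trans leK (le_trans _ geL).
  have gain_rho := section_integral_gain j.+3 A B H eta rho isT B0 (ltW eta0) gain rho01.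
  have S0 : (0 <= section_integral j.+3 1 0 1 rho)%E.
    by apply: integral_ge0 => s _; rewrite lee_fin section_profile_ge0.
  have bk0 : 0 <= kappa' * ((1 + w) ^- j.+4 * ((1 - w) / 2 * lam) ^+ j.+4).
    by rewrite mulr_ge0// ltW.
  apply: le_trans (lee_wpmul2l _ gain_rho); last by rewrite lee_fin.
  rewrite muleA -EFinM lee_wpmul2r// lee_fin -[leRHS]mulrA ler_wpM2l ?(ltW kappa'0)//.
  by rewrite [leRHS]mulrC; exact: ratio.
have [_ leL] := proj_body_volume_bounds R delta A B H w lam kappa 1 j.+4 j.+4
  id d1 A0 B0 lam0 smallL w0 w4 kappa0 volE.
have [geK _] := proj_body_volume_bounds R delta 1 0 1 w lam kappa 1 j.+4 j.+4
  id d1 ltr01 (lexx 0) lam0 smallK w0 w4 kappa0 volE.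
rewrite !section_integral1 in leL geK; rewrite profile_integral_cylinder in geK.
have V0 : (0 <= profile_integral j.+4 A B H)%E.
  by apply: integral_ge0 => s _; rewrite lee_fin profile_ge0.
have [v v0 vE] : exists2 v : R, 0 <= v & profile_integral j.+4 A B H = v%:E.
  have Vfin : profile_integral j.+4 A B H \is a fin_num.
    rewrite ge0_fin_numE//; apply: le_lt_trans (ltry 2); apply: le_trans volL.
    by rewrite leeDl// lee_fin ltW.
  by exists (fine (profile_integral j.+4 A B H)); rewrite ?fine_ge0 ?fineK.
rewrite vE in leL volL; rewrite -EFinD lee_fin in volL.
rewrite /vol; apply: (@lt_le_trans _ _ ((2 ^+ j.+1.+4)%:E *
    ((kappa * ((1 + w) ^- j.+1.+4 * ((1 - w) / 2 * lam) ^+ j.+1.+4))%:E * 2%:E))%E).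
  apply: (@le_lt_trans _ _ ((2 ^+ j.+1.+4)%:E *
    ((kappa * ((1 - w) ^- j.+1.+4 * ((1 + w) / 2 * lam) ^+ j.+1.+4))%:E * v%:E))%E).
    by apply: lee_wpmul2l => //; rewrite lee_fin exprn_ge0.
  have := ratio j.+1.+4 lam (leqnn _) lam0; have := b0 j.+1.+4.
  move: ((1 + w) ^- _ * _) ((1 - w) ^- _ * _) => b a b_gt0 ab.
  rewrite -!EFinM lte_fin ltr_pM2l ?exprn_gt0// -!mulrA ltr_pM2l//.
  (* The loss of volume outweighs the distortion: (1 + eta/2)(2 - eta) = 2 - eta^2/2 < 2. *)
  apply: le_lt_trans (_ : (1 + eta / 2) * b * (2 - eta) < _).
    apply: le_trans (ler_wpM2r v0 ab) _; rewrite ler_wpM2l ?lerBrDr//.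
    by rewrite mulr_ge0 ?addr_ge0 ?(ltW eta20) ?(ltW b_gt0).
  rewrite -subr_gt0 (_ : _ - _ = b * (eta ^+ 2 / 2)); last by field.
  by rewrite mulr_gt0// divr_gt0// exprn_gt0.
by apply: lee_wpmul2l => //; rewrite lee_fin exprn_ge0.
Qed.
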